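(* Let $\mu\in(0,1)$. For any value $c<H(L_1)$, the regularized planar circular restricted three body problem has a closed orbit with energy $c$; that is, on the regularized (compact) energy hypersurface $\overline{\Sigma}_c^E\sqcup\overline{\Sigma}_c^M$ the one-dimensional foliation tangent to the kernel of its Hamiltonian structure has a closed leaf.
   Context: Setting. Fix $\mu\in(0,1)$, $E=(\mu,0)$ (earth, mass $1-\mu$), $M=(-(1-\mu),0)$ (moon, mass $\mu$). On $(\mathbb{R}^2\setminus\{E,M\})\times\mathbb{R}^2\ni(q,p)$ with symplectic form $\omega=dp_1\wedge dq_1+dp_2\wedge dq_2$ let $$H(q,p)=\tfrac12|p|^2-\frac{1-\mu}{|q-E|}-\frac{\mu}{|q-M|}+p_1q_2-p_2q_1=\tfrac12\big((p_1+q_2)^2+(p_2-q_1)^2\big)+U(q),$$ $$U(q)=-\frac{1-\mu}{|q-E|}-\frac{\mu}{|q-M|}-\tfrac12|q|^2 .$$ $\ell^1$ is the critical point of $U$ on the open segment between $E$ and $M$, and $L_1=(\ell^1_1,\ell^1_2,-\ell^1_2,\ell^1_1)$ is the corresponding critical point of $H$ (in coordinates $(q_1,q_2,p_1,p_2)$), so $H(L_1)=U(\ell^1)$. Put $\Sigma_c=H^{-1}(c)$, let $\pi(q,p)=q$, and let $\mathcal{K}_c=\pi(\Sigma_c)=\{q: U(q)\le c\}$ be the Hill's region. For $c<H(L_1)$, $\mathcal{K}_c$ has three connected components: an unbounded one and two bounded ones $\mathcal{K}_c^E,\mathcal{K}_c^M$ with $E\in\mathrm{cl}(\mathcal{K}_c^E)$,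 $M\in\mathrm{cl}(\mathcal{K}_c^M)$; put $\Sigma_c^E=\pi^{-1}(\mathcal{K}_c^E)\cap\Sigma_c$, $\Sigma_c^M=\pi^{-1}(\mathcal{K}_c^M)\cap\Sigma_c$. Moser regularization. For a primary $P\in\{E,M\}$ put $x=-p$, $y=q-P$, and let $(\xi,\eta)\in T^*S^2$ (with $\xi=(\xi_0,\xi_1,\xi_2)\in S^2\subset\mathbb{R}^3$, $\eta\in\mathbb{R}^3$, $\xi\cdot\eta=0$, $TS^2$ and $T^*S^2$ being identified by the round metric) be determined by $x_k=\xi_k/(1-\xi_0)$, $y_k=\eta_k(1-\xi_0)+\xi_k\eta_0$, $k=1,2$ (the cotangent lift of inverse stereographic projection from the north pole $N=(1,0,0)$). This defines a symplectic embedding $\Phi_P:(q,p)\mapsto(\xi,\eta)$ into $T^*S^2$ with symplectic form $d(\eta\, d\xi)$, where $\eta\,d\xi$ is the canonical 1-form. For $c<H(L_1)$, $\overline{\Sigma}_c^P$ ($P=E,M$) is the closure of $\Phi_P(\Sigma_c^P)$ in $T^*S^2$; it is a closed hypersurface obtained by adding a circle in the fibre over $N$ (collisions), and is endowed with the restriction of the symplectic form, a closed two-form with one-dimensional kernel (its Hamiltonian structure). Up to reparametrization, the leaves of this kernel are the (regularized) orbits of energy $c$. *)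

(* Defs.v *)
From HB Require Import structures.
From mathcomp Require Import all_boot all_order all_algebra.
From mathcomp Require Import all_classical all_reals all_analysis.

Set Implicit Arguments.
Unset Strict Implicit.
Unset Printing Implicit Defensive.

Import Order.TTheory GRing.Theory Num.Theory.
Import numFieldNormedType.Exports.

Local Open Scope classical_set_scope.
Local Open Scope ring_scope.

Section Euclidean.
Context {R : realType}.

Definition dot n (u v : 'rV[R]_n) : R := \sum_(i < n) u 0 i * v 0 i.

(* The library's `|u| on row vectors is the sup norm. *)
Definition enorm n (u : 'rV[R]_n) : R := Num.sqrt (dot u u).

Definition vec2 (a b : R) : 'rV[R]_2 := \row_(k < 2) [:: a; b]`_k.

End Euclidean.

Notation plane R := ('rV[R]_2).
Notation phase R := ('rV[R]_2 * 'rV[R]_2)%type.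
(* (xi, eta) in R^3 x R^3, the ambient space of T^*S^2 *)
Notation ambient R := ('rV[R]_3 * 'rV[R]_3)%type.

Variant primary := Earth | Moon.

Section ThreeBody.
Context {R : realType}.
Implicit Types (mu c : R) (P : primary).

Definition position mu P : plane R :=
  match P with
  | Earth => vec2 mu 0
  | Moon => vec2 (- (1 - mu)) 0
  end.

(* As 0^-1 = 0 in the library, [potential] and [hamiltonian] take meaningless
   values at the two primaries, which are therefore excluded explicitly below. *)
Definition potential mu (q : plane R) : R :=
  - ((1 - mu) / enorm (q - position mu Earth))
  - mu / enorm (q - position mu Moon)
  - 2^-1 * enorm q ^+ 2.

Definition hamiltonian mu (w : phase R) : R :=
  let q := w.1 in let p := w.2 in
  2^-1 * enorm p ^+ 2
  - (1 - mu) / enorm (q - position mu Earth)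
  - mu / enorm (q - position mu Moon)
  + p 0 0 * q 0 1 - p 0 1 * q 0 0.

Definition critical_point n (f : 'rV[R]_n -> R) (x : 'rV[R]_n) : Prop :=
  differentiable f x /\ forall v, 'd f x v = 0.

Definition open_segment n (x y : 'rV[R]_n) : set 'rV[R]_n :=
  [set z | exists t : R, 0 < t < 1 /\ z = (1 - t) *: x + t *: y].

Definition is_ell1 mu (l : plane R) : Prop :=
  open_segment (position mu Earth) (position mu Moon) l /\
  critical_point (potential mu) l.

Definition L1 (l : plane R) : phase R := (l, vec2 (- l 0 1) (l 0 0)).

Definition energy_surface mu c : set (phase R) :=
  [set w | [/\ w.1 <> position mu Earth, w.1 <> position mu Moon
             & hamiltonian mu w = c]].

Definition hill_region mu c : set (plane R) :=
  fst @` energy_surface mu c.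

(* The points whose connected component in the Hill's region is bounded and has
   the primary P in its closure.  The Hill's region contains a punctured disc
   around P, so there is exactly one such component. *)
Definition hill_component mu c P : set (plane R) :=
  [set q | [/\ hill_region mu c q,
               bounded_set (connected_component (hill_region mu c) q)
             & closure (connected_component (hill_region mu c) q)
                 (position mu P)]].

Definition energy_component mu c P : set (phase R) :=
  energy_surface mu c `&` fst @^-1` hill_component mu c P.

(* T^*S^2, identified with TS^2 by the round metric *)
Definition cotangent_sphere : set (ambient R) :=
  [set z | dot z.1 z.1 = 1 /\ dot z.1 z.2 = 0].

(* The graph of Phi_P; xi_0 <> 1 says that xi is not the north pole, and for
   k : 'I_2 the coordinate [lift 0 k] of R^3 is the one following k. *)
Definition moser_graph mu P (w : phase R) (z : ambient R) : Prop :=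
  let x := - w.2 in let y := w.1 - position mu P in
  let xi := z.1 in let eta := z.2 in
  [/\ cotangent_sphere z, xi 0 0 <> 1 &
      forall k : 'I_2,
        x 0 k = xi 0 (lift 0 k) / (1 - xi 0 0) /\
        y 0 k = eta 0 (lift 0 k) * (1 - xi 0 0) + xi 0 (lift 0 k) * eta 0 0].

Definition moser_image mu P (A : set (phase R)) : set (ambient R) :=
  [set z | exists2 w, A w & moser_graph mu P w z].

Definition regularized_surface mu c P : set (ambient R) :=
  cotangent_sphere `&` closure (moser_image mu P (energy_component mu c P)).

(* d(eta dxi) = sum_i d eta_i /\ d xi_i *)
Definition symplectic_form (u v : ambient R) : R :=
  dot u.2 v.1 - dot v.2 u.1.

(* Velocities at z of curves in S: the tangent space when S is a submanifold. *)
Definition tangent_space (S : set (ambient R)) (z : ambient R)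
    : set (ambient R) :=
  [set v | exists s : R -> ambient R,
     [/\ s 0 = z, \forall t \near (0 : R), S (s t)
       & is_derive (0 : R) (1 : R) s v]].

Definition characteristic_kernel (S : set (ambient R)) (z : ambient R)
    : set (ambient R) :=
  [set u | tangent_space S z u /\
           forall v, tangent_space S z v -> symplectic_form u v = 0].

(* L is a closed leaf of the characteristic foliation of the hypersurface S:
   a C^1 embedded circle in S everywhere tangent to the kernel line field.
   Such an L is open (same dimension) and compact in the leaf containing it,
   hence is that whole leaf. *)
Definition closed_leaf (S L : set (ambient R)) : Prop :=
  exists (T : R) (g : R -> ambient R),
    0 < T /\ L = range g /\
    [/\ forall t, derivable g t 1,
        continuous (derive1 g),
        forall t, derive1 g t <> 0,
        forall t, g (t + T) = g t
      & forall s t, 0 <= s < T -> 0 <= t < T -> g s = g t -> s = t] /\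
    forall t, S (g t) /\ characteristic_kernel S (g t) (derive1 g t).

End ThreeBody.

(* Main.v *)
(** Birkhoff's shooting argument for a retrograde orbit around the earth.  Put the earth at the
    origin and pass to Levi-Civita coordinates q - E = z^2, z = u + i w.  In regularized time the
    flow on H = c becomes z'' = - grad W / 4 - 2 i |z|^2 z' on 2 |z'|^2 + W = 0, where
    W = |z|^2 (U - c).  Below the first critical value u W_u > 0 and w W_w > 0 hold on the
    component of the Hill's region around the earth.  Shoot orthogonally from (s, 0), 0 <= s <= c*,
    in the direction - i, where (c*, 0) is the zero velocity point.  As long as u > 0 and w' < 0
    both potential and Coriolis forces give u'' < 0 and hence u' < 0, so the orbit leaves this
    region in finite time, and whenever w' vanishes first one has w'' > 0.  Hence reaching u = 0
    with w' < 0 and reaching w' = 0 with u > 0 are disjoint open conditions on s; the first holds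
    for s = 0 (collision) and the second for s = c*, so some orbit reaches u = 0 and w' = 0
    simultaneously.  Reflecting it in both axes gives an orbit closed up to z -> - z, that is a
    simple closed collision-free curve in the q-plane, which is then carried to T^*S^2. *)

(* The slope inequalities come from the critical point itself. Let [t] be the distance from the
   earth to ell1. There grad U = 0, so the gradient of W = |z|^2 (U - c) is U(ell1) - c times the
   gradient of |z|^2, and the slope in the w-direction is exactly the energy gap U(ell1) - c > 0.
   The estimates show that ell1 is the worst point of the closed disc |q - E| <= t for both slopes.
   On the boundary circle U > c, so the disc also traps the orbits, and it contains every component
   of the Hill's region that meets its interior. All bounds hold for every mass ratio, so the orbit
   is always found around the earth. The regularized surface is a closure, and its tangent vectors
   are velocities of curves. The orbit avoids collisions, hence stays off the fibre over N. There
   every tangent vector satisfies the linear equations of T T^*S^2 and dH = 0, and these already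
   force the symplectic pairing with the flow direction to vanish. *)
Require Import Defs.
From mathcomp Require Import all_boot all_order all_algebra.
From mathcomp Require Import all_classical all_reals all_analysis.
From mathcomp Require Import ring lra.
Import Order.TTheory GRing.Theory Num.Theory.
Import numFieldNormedType.Exports.
Local Open Scope classical_set_scope.
Local Open Scope ring_scope.
Set Implicit Arguments.
Unset Strict Implicit.
Unset Printing Implicit Defensive.

(** * Calculus of one real variable *)

Section Calculus.
Context {R : realType}.
Implicit Types (f g F df : R -> R) (a b c d x t : R).

(** A plain proposition in place of the class [is_derive], so that derivatives are assembled from
    explicit terms and compared with the expected value by [der_eq]. *)
Definition has_deriv f x a : Prop := is_derive x 1 f a.

Lemma derC (k x : R) : has_deriv (fun=> k) x 0.
Proof. exact: is_derive_cst. Qed.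

Lemma derI x : has_deriv (fun y => y) x 1.
Proof. exact: is_derive_id. Qed.

Lemma derD f g x a b : has_deriv f x a -> has_deriv g x b ->
  has_deriv (fun y => f y + g y) x (a + b).
Proof. by move=> ? ?; exact: is_deriveD. Qed.

Lemma derN f x a : has_deriv f x a ->
  has_deriv (fun y => - f y) x (- a).
Proof. by move=> ?; exact: is_deriveN. Qed.

Lemma derM f g x a b : has_deriv f x a -> has_deriv g x b ->
  has_deriv (fun y => f y * g y) x (a * g x + f x * b).
Proof.
move=> fa gb; apply: is_derive_eq (@is_deriveM R R f g x 1 a b fa gb) _.
by rewrite /GRing.scale/= addrC mulrC.
Qed.

Lemma derX f n x a : has_deriv f x a ->
  has_deriv (fun y => f y ^+ n.+1) x (n.+1%:R * f x ^+ n * a).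
Proof.
move=> fa; elim: n => [|n IH].
  by apply: is_derive_eq fa _; rewrite expr0 !mul1r.
have := derM fa IH; under eq_fun do rewrite -exprS.
by move=> h; apply: is_derive_eq h _; rewrite exprS -(natr1 n.+1); ring.
Qed.

Lemma derV f x a : f x != 0 -> has_deriv f x a ->
  has_deriv (fun y => (f y)^-1) x (- a / f x ^+ 2).
Proof.
move=> fx fa; apply: is_derive_eq (is_deriveV fx fa) _.
by rewrite /GRing.scale/= !mulNr mulrC.
Qed.

Lemma derComp f g x a b : has_deriv f (g x) a ->
  has_deriv g x b -> has_deriv (fun y => f (g y)) x (a * b).
Proof. by move=> ? ?; exact: is_derive1_comp. Qed.

Lemma derSqrt f x a : 0 < f x -> has_deriv f x a ->
  has_deriv (fun y => Num.sqrt (f y)) x ((2 * Num.sqrt (f x))^-1 * a).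
Proof. by move=> f0 fa; apply: derComp fa; exact: is_derive1_sqrt. Qed.

Lemma der_eq f g x a b : has_deriv f x a -> f =1 g -> a = b ->
  has_deriv g x b.
Proof. by move=> fa /funext <- <-. Qed.

Lemma der_unique f x a b : has_deriv f x a -> has_deriv f x b -> a = b.
Proof. by move=> [_ <-] [_ <-]. Qed.

Lemma der_flip f x d : has_deriv f (- x) d ->
  has_deriv (fun y => f (- y)) x (- d).
Proof. by move=> h; have := derComp (g := fun y => - y) h (derN (derI x)); rewrite mulrN1. Qed.

Lemma der_reflect f x c d : has_deriv f (c - x) d ->
  has_deriv (fun y => f (c - y)) x (- d).
Proof.
move=> h; have := derComp (g := fun y => c - y) h (derD (derC c x) (derN (derI x))).
by rewrite add0r mulrN1.
Qed.

Lemma der_cont f x a : has_deriv f x a -> {for x, continuous f}.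
Proof. by move=> [df _]; apply/differentiable_continuous/derivable1_diffP. Qed.

Lemma der_contT f df : (forall x, has_deriv f x (df x)) -> continuous f.
Proof. by move=> h x; exact: der_cont (h x). Qed.

Lemma mean_value f df a b : a < b -> (forall x, a <= x <= b -> has_deriv f x (df x)) ->
  exists2 c, a < c < b & f b - f a = df c * (b - a).
Proof.
move=> ab H; have [||c] := @MVT R f df a b ab.
- by move=> x; rewrite in_itv/= => /andP[/ltW ? /ltW ?]; apply: H; apply/andP.
- apply: continuous_in_subspaceT => x; rewrite inE/= in_itv/= => xab.
  exact: der_cont (H _ xab).
- by rewrite in_itv/=; exists c.
Qed.

Lemma nondecreasing_derive f df a b : a <= b ->
  (forall x, a <= x <= b -> has_deriv f x (df x)) ->
  (forall x, a < x < b -> 0 <= df x) -> f a <= f b.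
Proof.
rewrite le_eqVlt => /predU1P[->//|ab] H df0.
have [c cab fab] := mean_value ab H.
by rewrite -subr_ge0 fab mulr_ge0 ?df0// subr_ge0 ltW.
Qed.

Lemma increasing_derive f df a b : a < b ->
  (forall x, a <= x <= b -> has_deriv f x (df x)) ->
  (forall x, a < x < b -> 0 < df x) -> f a < f b.
Proof.
move=> ab H df0; have [c cab fab] := mean_value ab H.
by rewrite -subr_gt0 fab mulr_gt0 ?df0// subr_gt0.
Qed.

Lemma constant_derive f a b : a <= b ->
  (forall x, a <= x <= b -> has_deriv f x 0) -> f a = f b.
Proof.
rewrite le_eqVlt => /predU1P[->//|ab] H.
have [c cab] := mean_value ab H.
by rewrite mul0r => /eqP; rewrite subr_eq0 => /eqP.
Qed.

(** The integral over [a, x] has derivative [f x] only to the right of [a]; [primitive_exists] glues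
    these one-sided primitives. *)
Lemma primitive_from a f : continuous f ->
  exists F, forall x, a < x -> has_deriv F x (f x).
Proof.
move=> cf; pose F x := (\int[lebesgue_measure]_(t in [set` `[a, x]]) f t)%R.
exists F => x ax.
have [||dF F'] := @continuous_FTC1_closed R f a x (x + 1) _ _ ax (cf x).
- by rewrite ltrDl.
- apply: continuous_compact_integrable; first exact: segment_compact.
  exact: continuous_subspaceT.
- by rewrite -F' derive1E; exact: DeriveDef.
Qed.

Lemma primitive_exists f : continuous f ->
  exists F, F 0 = 0 /\ forall x, has_deriv F x (f x).
Proof.
move=> cf.
have /choice[G HG] : forall n : nat, exists G : R -> R, forall x : R, - n.+1%:R < x ->
    has_deriv G x (f x) by move=> n; exact: primitive_from.
pose N (x : R) := Num.truncn `|x|.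
(* At [x] take a primitive based to the left of [- |x|], normalised to vanish at 0; any two choices
   agree where both are defined. *)
pose F x : R := G (N x) x - G (N x) 0.
have FE n x : `|x| < n.+1%:R -> F x = G n x - G n 0.
  move=> xn; rewrite /F.
  have xN : `|x| < (N x).+1%:R by rewrite truncnS_gt.
  pose h (y : R) : R := G (N x) y - G n y.
  suff : h x = h 0 by rewrite /h; lra.
  have dh y : - (N x).+1%:R < y -> - n.+1%:R < y -> has_deriv h y 0.
    move=> y1 y2; apply: der_eq (derD (HG _ _ y1) (derN (HG _ _ y2))) _ _ => //.
    by rewrite subrr.
  have [x0|x0] := leP 0 x.
    rewrite (@constant_derive h 0 x)// => y /andP[y0 _]; apply: dh.
      by rewrite (lt_le_trans _ y0)// oppr_lt0.
    by rewrite (lt_le_trans _ y0)// oppr_lt0.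
  rewrite (@constant_derive h x 0)// ?ltW// => y /andP[y0 _]; apply: dh.
    by move: xN; rewrite ltr0_norm//; lra.
  by move: xn; rewrite ltr0_norm//; lra.
exists F; split; first by rewrite /F subrr.
(* One index more than [x] requires, so that a single primitive serves the whole unit ball around
   [x]. *)
move=> x; pose n := (N x).+1.
have xn : `|x| < n%:R by rewrite truncnS_gt.
have dG : has_deriv (fun y => G n y - G n 0) x (f x).
  apply: der_eq (derD (HG n x _) (derC _ _)) _ _ => //; last by rewrite addr0.
  by move: xn; rewrite ltr_norml -natr1; lra.
apply: near_eq_is_derive dG.
near=> y; symmetry; apply: FE.
have xy : `|x - y| < 1 by near: y; exact: (nbhsx_ballx x 1 ltr01).
have : `|y| <= `|x| + `|x - y| by rewrite -[in leLHS](subKr x y) ler_normB.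
by rewrite -natr1; move: xn xy; lra.
Unshelve. all: by end_near. Qed.

End Calculus.

(** * Continuity of real functions at a point *)

Section PointwiseContinuity.
Context {R : realType} {T : topologicalType}.
Implicit Types (f g : T -> R) (x : T) (c : R).

Definition cont_at f x : Prop := {for x, continuous f}.

Lemma catC c x : cont_at (fun=> c) x. Proof. exact: cvg_cst. Qed.

Lemma catD f g x : cont_at f x -> cont_at g x -> cont_at (fun y => f y + g y) x.
Proof. exact: cvgD. Qed.

Lemma catN f x : cont_at f x -> cont_at (fun y => - f y) x.
Proof. exact: cvgN. Qed.

Lemma catM f g x : cont_at f x -> cont_at g x -> cont_at (fun y => f y * g y) x.
Proof. exact: cvgM. Qed.

Lemma catX f n x : cont_at f x -> cont_at (fun y => f y ^+ n) x.
Proof.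
move=> cf; elim: n => [|n IH]; first exact: catC.
have -> : (fun y => f y ^+ n.+1) = (fun y => f y * f y ^+ n) by apply/funext => y; rewrite exprS.
exact: catM.
Qed.

Lemma catV f x : f x != 0 -> cont_at f x -> cont_at (fun y => (f y)^-1) x.
Proof. exact: cvgV. Qed.

Lemma cat_sqrt f x : cont_at f x -> cont_at (fun y => Num.sqrt (f y)) x.
Proof. by move=> cf; apply: (continuous_comp cf); exact: sqrt_continuous. Qed.

End PointwiseContinuity.

Lemma cat_coord {R : realType} m n (i : 'I_m) (j : 'I_n) (M : 'M[R]_(m, n)) :
  cont_at (fun M : 'M[R]_(m, n) => M i j) M.
Proof. exact: coord_continuous. Qed.

(** * Sign changes of continuous functions and connectedness of an interval *)

Section SignChanges.
Context {R : realType}.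

Lemma neg_near (f : R -> R) x : {for x, continuous f} -> f x < 0 ->
  exists d, 0 < d /\ forall y, `|y - x| < d -> f y < 0.
Proof.
move=> cf fx; have fx' : 0 < - f x by rewrite oppr_gt0.
move/cvgrPdist_lt : cf => /(_ _ fx') [d /= d0 hd]; exists d; split => // y yx.
have /hd : ball_ [eta Num.Def.normr] x d y by rewrite /ball_/= distrC.
by rewrite ltr_norml; lra.
Qed.

Lemma pos_near (f : R -> R) x : {for x, continuous f} -> 0 < f x ->
  exists d, 0 < d /\ forall y, `|y - x| < d -> 0 < f y.
Proof.
move=> cf fx; have [|//|d [d0 hd]] := @neg_near (fun y => - f y) x.
- exact: cvgN.
- by rewrite oppr_lt0.
- by exists d; split => // y /hd; rewrite oppr_lt0.
Qed.

Lemma nonpos_limit (h : R -> R) (T : R) : continuous h -> 0 < T ->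
  (forall r : R, 0 <= r < T -> h r < 0) -> forall r : R, 0 <= r <= T -> h r <= 0.
Proof.
move=> ch T0 hT r /andP[r0 rT]; rewrite leNgt; apply/negP => hr0.
have rT' : r = T.
  by apply/eqP; rewrite eq_le rT leNgt; apply/negP => rT'; have := hT r; rewrite r0 rT' => /(_ isT); lra.
have [d [d0 hd]] := pos_near (ch r) hr0.
pose r' := Num.max 0 (T - d / 2).
have r'T : 0 <= r' < T by rewrite /r' le_max lexx gt_max T0/=; lra.
have h1 : T - d / 2 <= r' by rewrite /r' le_max lexx orbT.
have h2 : `|r' - r| < d by rewrite rT' ltr0_norm; lra.
by have := hd r' h2; have := hT _ r'T; lra.
Qed.

(** Connectedness of [0, c] through the supremum [s] of the points satisfying [P]: if [P s],
    openness leads beyond [s]; if [Q s], openness reaches points of [P] just below [s]. *)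
Lemma two_opens (P Q : R -> Prop) c : 0 <= c -> P 0 -> Q c ->
  (forall s, 0 <= s <= c -> P s \/ Q s) -> (forall s, P s -> Q s -> False) ->
  (forall s, P s -> exists d, 0 < d /\ forall r, `|r - s| < d -> P r) ->
  (forall s, Q s -> exists d, 0 < d /\ forall r, `|r - s| < d -> Q r) -> False.
Proof.
move=> c0 P0 Qc PQ disj oP oQ.
pose S : set R := [set s | 0 <= s <= c /\ P s].
have S0 : S 0 by split; rewrite ?lexx.
have hS : has_sup S by split; [exists 0|exists c => s [/andP[]]].
pose s := sup S.
have s0 : 0 <= s by exact: sup_upper_bound.
have sc : s <= c by apply: ge_sup; [exists 0|move=> r [/andP[]]].
have [|Ps|Qs] := PQ s; first by rewrite s0.
- have sc' : s < c by rewrite lt_def sc andbT; apply/eqP => cs; apply: disj Qc; rewrite cs.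
  have [d [d0 hd]] := oP _ Ps; pose r := Num.min c (s + d / 2).
  have sr : s < r by rewrite lt_min sc'; lra.
  have rs : r <= s + d / 2 by rewrite ge_min lexx orbT.
  have rc : r <= c by rewrite ge_min lexx.
  have : S r.
    split; first by rewrite rc andbT; lra.
    by apply: hd; rewrite gtr0_norm; lra.
  by move=> /(sup_upper_bound hS); rewrite leNgt sr.
- have [d [d0 hd]] := oQ _ Qs.
  have [r Sr sr] := sup_adherent d0 hS; have rs := sup_upper_bound hS Sr.
  case: (Sr) => _ Pr; apply: (disj r) => //; apply: hd.
  by rewrite ler0_norm ?subr_le0//; rewrite -/s in sr; lra.
Qed.

Lemma near_neq (f : R -> R) x y : cont_at f x -> f x <> y -> \forall s \near x, f s <> y.
Proof.
move=> cf fy; have e0 : 0 < `|f x - y| by rewrite normr_gt0 subr_eq0; apply/eqP.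
have /cvgrPdist_lt/(_ _ e0) := cf.
by apply: filterS => s /= + E; rewrite E ltxx.
Qed.

Lemma first_zero (h : R -> R) (s : R) : continuous h -> 0 <= s -> h 0 < 0 -> 0 <= h s ->
  exists T : R, [/\ 0 < T <= s, h T = 0 & forall r : R, 0 <= r < T -> h r < 0].
Proof.
move=> ch s0 h0 hs; pose S : set R := [set r | 0 <= r /\ 0 <= h r].
have Ss : S s by [].
have lS : lbound S 0 by move=> r [].
have hi : has_inf S by split; [exists s|exists 0].
pose T := inf S.
have T0 : 0 <= T by apply: lb_le_inf => //; exists s.
have below r : 0 <= r < T -> h r < 0.
  move=> /andP[r0 rT]; rewrite ltNge; apply/negP => hr.
  by have := ge_inf hi.2 (conj r0 hr : S r); rewrite leNgt rT.
have Ts : T <= s by exact: ge_inf hi.2 _ Ss.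
have hT_ge : 0 <= h T.
  rewrite leNgt; apply/negP => hT.
  have := ch T => /cvgrPdist_lt /(_ (- h T)); rewrite oppr_gt0 => /(_ hT) [d /= d0 hd].
  have [x Sx xT] := inf_adherent d0 hi.
  have Tx : T <= x by exact: ge_inf hi.2 _ Sx.
  have /hd : ball_ [eta Num.Def.normr] T d x.
    by rewrite /ball_/= distrC ger0_norm ?subr_ge0//; rewrite -/T in xT; lra.
  by case: Sx => _; rewrite ltr_norml; lra.
have hT_le : h T <= 0.
  rewrite leNgt; apply/negP => hT.
  have T1 : 0 < T by rewrite lt_def T0 andbT; apply/eqP => T_0; move: hT; rewrite T_0; lra.
  have := ch T => /cvgrPdist_lt /(_ _ hT) [d /= d0 hd].
  pose x := Num.max 0 (T - d / 2).
  have xT : 0 <= x < T by rewrite /x le_max lexx gt_max T1/=; lra.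
  have := below x xT.
  have /hd : ball_ [eta Num.Def.normr] T d x.
    rewrite /ball_/= ger0_norm; last by lra.
    have : T - d / 2 <= x by rewrite /x le_max lexx orbT.
    lra.
  by rewrite ltr_norml; lra.
exists T; split => //; last by apply/eqP; rewrite eq_le hT_le.
rewrite Ts lt_def T0 !andbT; apply/eqP => T_0.
by move: hT_ge; rewrite T_0; lra.
Qed.

End SignChanges.

(** * Ordinary differential equations *)

Section Ode.
Context {R : realType}.
Implicit Types (f h : R -> R) (a b t s C D M L A l : R).

Lemma derSum n (f : 'I_n -> R -> R) (df : 'I_n -> R) t :
  (forall i, has_deriv (f i) t (df i)) ->
  has_deriv (fun s => \sum_(i < n) f i s) t (\sum_(i < n) df i).
Proof.
move=> fdf; apply: der_eq; [exact: (@is_derive_sum R R R n f t 1 df fdf)| |by []].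
by move=> s; rewrite fct_sumE.
Qed.

Lemma lipschitz_continuous f (C : R) :
  (forall s t, `|f s - f t| <= C * `|s - t|) -> continuous f.
Proof.
have C0 : 0 < `|C| + 1 by rewrite ltr_wpDl.
move=> fC t; apply/cvgrPdist_le => /= e e0.
have d0 : 0 < e / (`|C| + 1) by rewrite divr_gt0.
near=> s.
apply: le_trans (fC _ _) _.
have st : `|t - s| < e / (`|C| + 1).
  by near: s; exact: (nbhsx_ballx t _ d0).
apply: (@le_trans _ _ ((`|C| + 1) * `|t - s|)).
  by rewrite ler_wpM2r// (le_trans (ler_norm _))// lerDl.
by rewrite mulrC -ler_pdivlMr// ltW.
Unshelve. all: by end_near. Qed.

Lemma bounded_deriv_lipschitz h dh M :
  (forall t, has_deriv h t (dh t)) -> (forall t, `|dh t| <= M) ->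
  forall s t, `|h s - h t| <= M * `|s - t|.
Proof.
move=> hdh dhM.
suff H s t : s <= t -> `|h s - h t| <= M * `|s - t|.
  by move=> s t; have [/H//|/ltW/H] := leP s t; rewrite distrC (distrC t).
rewrite le_eqVlt => /predU1P[->|st]; first by rewrite !subrr !normr0 mulr0.
have [c _] := mean_value st (fun x _ => hdh x).
by rewrite distrC (distrC s) => ->; rewrite normrM ler_wpM2r.
Qed.

Lemma ler_geometric a b c : (forall k, a <= b + c / 2 ^+ k) -> a <= b.
Proof.
move=> H; apply/ler_addgt0Pr => e e0.
pose k := Num.truncn (`|c| / e).
apply: le_trans (H k) _; rewrite lerD2l ler_pdivrMr ?exprn_gt0// mulrC -ler_pdivrMr//.
apply: (@le_trans _ _ (`|c| / e)); first by rewrite ler_pM2r ?invr_gt0// ler_norm.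
apply: (@le_trans _ _ (k.+1%:R)); first by rewrite ltW// truncnS_gt.
by rewrite -natrX ler_nat ltn_expl.
Qed.

Lemma ler_dist3 (a b c d A B M : R) :
  `|a - c| <= A -> `|b - d| <= B -> `|c - d| <= M -> `|a - b| <= M + (A + B).
Proof. by rewrite !ler_norml; lra. Qed.

Lemma ler_dist_half (a b c A : R) :
  `|a - c| <= A -> `|b - c| <= A -> `|a - b| <= A + A.
Proof. by rewrite !ler_norml; lra. Qed.

Lemma ler_norm_sqr2 (a b : R) : `|2 * a| * `|b| <= a ^+ 2 + b ^+ 2.
Proof.
rewrite -normrM ler_norml.
by have := sqr_ge0 (a - b); have := sqr_ge0 (a + b); rewrite sqrrB sqrrD; lra.
Qed.

Lemma norm_le_of_sqr (x y : R) : 0 <= y -> x ^+ 2 <= y ^+ 2 -> `|x| <= y.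
Proof.
by move=> y0 xy; rewrite -(ler_sqr (x := `|x|)) ?nnegrE// real_normK ?num_real.
Qed.

Lemma lt_norm_of_sqr (x e : R) : 0 < e -> x ^+ 2 < e ^+ 2 -> `|x| < e.
Proof.
by move=> e0 xe; rewrite -(ltr_sqr (x := `|x|)) ?nnegrE ?(ltW e0)// real_normK ?num_real.
Qed.

Lemma expR_transfer (a b k s t : R) :
  a * expR (- k * t) <= b * expR (- k * s) -> a <= b * expR (k * (t - s)).
Proof.
rewrite -[a <= _](ler_pM2r (expR_gt0 (- k * t))) -mulrA -expRD.
by congr (_ <= _ * expR _); ring.
Qed.

(** The intervals of radius [2 * D / 2 ^+ k] around [x k] are nested, since the radius drops by
    [D / 2 ^+ k] at each step; the limit is the supremum of their left ends. *)
Lemma geometric_limit (x : nat -> R) D :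
  (forall k, `|x k.+1 - x k| <= D / 2 ^+ k) ->
  exists l, forall k, `|l - x k| <= 2 * D / 2 ^+ k.
Proof.
move=> H.
have pow k : 2 * D / 2 ^+ k.+1 = D / 2 ^+ k.
  by rewrite exprS; field; rewrite expf_neq0.
have pow2 k : 2 * D / 2 ^+ k = D / 2 ^+ k + D / 2 ^+ k by rewrite -mulrA mulr_natl mulr2n.
pose y k := x k - 2 * D / 2 ^+ k; pose z k := x k + 2 * D / 2 ^+ k.
have yS k : y k <= y k.+1.
  by move: (H k); rewrite ler_norml /y pow pow2; lra.
have zS k : z k.+1 <= z k.
  by move: (H k); rewrite ler_norml /z pow pow2; lra.
have D0 : 0 <= D by have := H 0%N; rewrite expr0 divr1; apply: le_trans.
have yz k : y k <= z k.
  have : 0 <= 2 * D / 2 ^+ k by rewrite divr_ge0 ?mulr_ge0 ?exprn_ge0.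
  by rewrite /y /z; lra.
have mono (k j : nat) : y k <= z j.
  have y_ i : y k <= y (k + i)%N.
    by elim: i => [|i IH]; rewrite ?addn0// addnS (le_trans IH).
  have z_ i : z (j + i)%N <= z j.
    by elim: i => [|i IH]; rewrite ?addn0// addnS (le_trans _ IH).
  by rewrite (le_trans (y_ j))// (le_trans (yz _))// addnC.
exists (sup (range y)) => k.
have sy : has_sup (range y).
  by split; [exists (y 0%N), 0%N|exists (z 0%N) => _ [i _ <-]].
have : y k <= sup (range y) by apply: sup_upper_bound => //; exists k.
have : sup (range y) <= z k by apply: ge_sup; [exact: sy.1|move=> _ [i _ <-]].
by rewrite /y /z ler_norml; lra.
Qed.

(* A smooth substitute for the weight exp (l |t|), in which the Picard iteration contracts. *)
Definition weight (l t : R) : R := expR (l * t) + expR (- l * t).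

Lemma weight_ge1 l t : 1 <= weight l t.
Proof.
by have := expR_ge1Dx (l * t); have := expR_ge1Dx (- l * t); rewrite /weight; lra.
Qed.

Lemma der_expR_lin l t : has_deriv (fun s => expR (l * s)) t (l * expR (l * t)).
Proof.
apply: der_eq; [apply: derComp; [exact: is_derive_expR|exact: derM (derC l t) (derI t)]|by []|].
by rewrite mul0r add0r mulr1 mulrC.
Qed.

(** With [q] the primitive of [A * weight l] vanishing at 0, both [q + h] and [q - h] are
    nondecreasing, so [|h| <= |q|]. The gained factor [1 / l] is the contraction rate of the Picard
    map. *)
Lemma weighted_primitive_bound l A h dh : 0 < l -> 0 <= A -> h 0 = 0 ->
  (forall t, has_deriv h t (dh t)) -> (forall t, `|dh t| <= A * weight l t) ->
  forall t, `|h t| <= A / l * weight l t.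
Proof.
move=> l0 A0 h0 hdh dhA t.
pose q s := A / l * (expR (l * s) - expR (- l * s)).
have dq s : has_deriv q s (A * weight l s).
  apply: der_eq; [apply: derM (derC _ _) (derD (der_expR_lin l s) (derN (der_expR_lin (- l) s)))|by []|].
  by rewrite /weight; field; lra.
have q0 : q 0 = 0 by rewrite /q !mulr0 subrr mulr0.
have q1 s : `|q s| <= A / l * weight l s.
  rewrite /q normrM ger0_norm ?divr_ge0 ?(ltW l0)// ler_wpM2l ?divr_ge0 ?(ltW l0)//.
  by have := expR_ge0 (l * s); have := expR_ge0 (- l * s); rewrite ler_norml /weight; lra.
have mono (e : R) : (e = 1) \/ (e = -1) ->
    forall a b, a <= b -> q a + e * h a <= q b + e * h b.
  move=> He a b ab.
  have dg s : has_deriv (fun s => q s + e * h s) s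
      (A * weight l s + (0 * h s + e * dh s)).
    exact: derD (dq s) (derM (derC _ _) (hdh s)).
  apply: (nondecreasing_derive ab (fun s _ => dg s)) => s _.
  by have := dhA s; rewrite ler_norml; case: He => ->; lra.
have [m1 m2] := (mono 1 (or_introl erefl), mono (-1) (or_intror erefl)).
have := q1 t; rewrite !ler_norml.
by have [t0|/ltW t0] := leP 0 t; have := m1 _ _ t0; have := m2 _ _ t0; rewrite q0 h0; lra.
Qed.

Variable n : nat.
Notation state := ('I_n -> R).
Implicit Types (F : state -> state) (x y : R -> state).

Definition lipschitz_field F L :=
  forall (v w : state) i, `|F v i - F w i| <= L * \sum_(j < n) `|v j - w j|.

Definition solves F x := forall t i, has_deriv (fun s => x s i) t (F (x t) i).

Lemma field_continuous F L C x : 0 <= L -> lipschitz_field F L ->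
  (forall i s t, `|x s i - x t i| <= C * `|s - t|) ->
  forall i, continuous (fun s => F (x s) i).
Proof.
move=> L0 FL xC i; apply: (@lipschitz_continuous _ (L * \sum_(j < n) C)) => s t.
apply: le_trans (FL _ _ _) _; rewrite -mulrA ler_wpM2l// mulr_suml.
by apply: ler_sum => j _; exact: xC.
Qed.

(** Boundedness of the field keeps every iterate [M]-Lipschitz, so the integrands are continuous;
    the global Lipschitz constant and the weight give a solution on the whole line at once, without
    local pieces. *)
Lemma picard_lindelof F L M : 0 <= L -> lipschitz_field F L ->
  (forall v i, `|F v i| <= M) ->
  forall v, exists x, (forall i, x 0 i = v i) /\ solves F x.
Proof.
move=> L0 FL FM v.
pose P (f : R -> R) : R -> R :=
  xget (fun=> 0) [set G | G 0 = 0 /\ forall t, has_deriv G t (f t)].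
have PP f : continuous f -> P f 0 = 0 /\ forall t, has_deriv (P f) t (f t).
  by move=> /primitive_exists[G HG]; rewrite /P; case: xgetP => // /(_ G).
pose T x : R -> state := fun t i => v i + P (fun s => F (x s) i) t.
pose lipM x := forall i s t, `|x s i - x t i| <= M * `|s - t|.
have cF x : lipM x -> forall i, continuous (fun s => F (x s) i).
  by move=> xM; exact: field_continuous FL xM.
have TM x : lipM x -> lipM (T x).
  move=> xM i s t; have [_ dP] := PP _ (cF _ xM i).
  by rewrite opprD addrACA subrr add0r; exact: (bounded_deriv_lipschitz dP).
have aux (a b : R) : 0 <= b -> a * b <= b / 2 * (2 * a + 1) by move=> ?; lra.
(* Makes [L * n / l] at most 1/2, so that [T] halves weighted distances; the summand 1 keeps [l]
   positive when [L] or [n] is 0. *)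
pose l := 2 * (L * n%:R) + 1.
have l0 : 0 < l by rewrite ltr_wpDl// mulr_ge0 ?mulr_ge0.
have M0 (i : 'I_n) : 0 <= M by apply: le_trans (FM v i).
have FD x y D t i : (forall j, `|x t j - y t j| <= D * weight l t) ->
    `|F (x t) i - F (y t) i| <= L * n%:R * D * weight l t.
  move=> xy; apply: le_trans (FL _ _ _) _; rewrite -!mulrA ler_wpM2l//.
  apply: (@le_trans _ _ (\sum_(j < n) D * weight l t)); first exact: ler_sum.
  by rewrite sumr_const card_ord mulr_natl.
have TD x y D : lipM x -> lipM y -> 0 <= D ->
    (forall t j, `|x t j - y t j| <= D * weight l t) ->
    forall t i, `|T x t i - T y t i| <= D / 2 * weight l t.
  move=> xM yM D0 xy t i; rewrite opprD addrACA subrr add0r.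
  have [px dpx] := PP _ (cF _ xM i); have [py dpy] := PP _ (cF _ yM i).
  have LD : 0 <= L * n%:R * D by rewrite !mulr_ge0.
  apply: le_trans (weighted_primitive_bound l0 LD _ (fun t => derD (dpx t) (derN (dpy t))) _ t) _.
  - by rewrite px py subrr.
  - by move=> s; exact: FD.
  - rewrite ler_wpM2r ?(le_trans ler01 (weight_ge1 _ _))//.
    by rewrite ler_pdivrMr//; exact: aux.
pose x := fix x k := if k is k'.+1 then T (x k') else fun=> v.
have xM k : lipM (x k).
  elim: k => [|k IH]; last exact: TM.
  by move=> i s t; rewrite subrr normr0 mulr_ge0// (M0 i).
have x0 k i : x k 0 i = v i.
  by case: k => [//|k]; rewrite /= /T (PP _ (cF _ (xM k) i)).1 addr0.
pose C : R := `|M| / l; have C0 : 0 <= C by rewrite divr_ge0// ltW.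
have xD k t i : `|x k.+1 t i - x k t i| <= C / 2 ^+ k * weight l t.
  elim: k t i => [|k IH] t i.
    rewrite expr0 divr1 /= /T addrAC subrr add0r.
    have [px dpx] := PP _ (cF _ (xM 0%N) i).
    apply: (weighted_primitive_bound l0 _ px dpx) => // s.
    apply: le_trans (FM _ _) _; apply: le_trans (ler_norm M) _.
    by rewrite ler_peMr ?weight_ge1.
  rewrite exprSr invfM mulrA; apply: (TD _ _ _ (xM k.+1) (xM k)) IH _ _.
  by rewrite divr_ge0 ?exprn_ge0.
have /choice[xl xlE] : forall t, exists w : state, forall i k,
    `|w i - x k t i| <= 2 * (C * weight l t) / 2 ^+ k.
  move=> t; have /choice[w Hw] : forall i : 'I_n, exists a : R, forall k,
    `|a - x k t i| <= 2 * (C * weight l t) / 2 ^+ k; last by exists w.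
  by move=> i; apply: geometric_limit => k; rewrite mulrAC; exact: xD.
have xlM : lipM xl.
  move=> i s t.
  apply: (@ler_geometric _ _ (2 * (C * weight l s) + 2 * (C * weight l t))) => k.
  by rewrite mulrDl; exact: ler_dist3 (xlE s i k) (xlE t i k) (xM k i s t).
(* The limit is a fixed point: both sides lie geometrically close to the iterate [x k.+1], for every
   [k]. *)
have xlT t i : xl t i = T xl t i.
  apply/eqP; rewrite -subr_eq0 -normr_le0.
  apply: (@ler_geometric _ _ (2 * C * weight l t)) => k; rewrite add0r.
  have xlD s j : `|xl s j - x k s j| <= 2 * C / 2 ^+ k * weight l s.
    by apply: le_trans (xlE s j k) _; rewrite le_eqVlt; apply/orP; left; apply/eqP; ring.
  have CD : 0 <= 2 * C / 2 ^+ k.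
    exact: divr_ge0 (mulr_ge0 (ler0n R 2) C0) (exprn_ge0 _ (ler0n R 2)).
  have := TD _ _ _ xlM (xM k) CD xlD t i.
  have := xlE t i k.+1; rewrite [x k.+1]/=.
  have -> : 2 * (C * weight l t) / 2 ^+ k.+1 = C * weight l t / 2 ^+ k.
    by rewrite exprS; field; rewrite expf_neq0.
  have -> : 2 * C / 2 ^+ k / 2 * weight l t = C * weight l t / 2 ^+ k.
    by field; rewrite expf_neq0.
  have -> : 2 * C * weight l t / 2 ^+ k = C * weight l t / 2 ^+ k + C * weight l t / 2 ^+ k.
    by field; rewrite expf_neq0.
  exact: ler_dist_half.
exists xl; split=> [i|t i].
  by rewrite xlT /T (PP _ (cF _ xlM i)).1 addr0.
have [_ dP] := PP _ (cF _ xlM i).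
apply: der_eq; [exact: derD (derC (v i) t) (dP t)|by move=> s; rewrite [in RHS]xlT|by rewrite add0r].
Qed.

(** The squared distance satisfies [|d'| <= K d], so [d] times [expR (- K r)] decreases and [d]
    times [expR (K r)] increases in [r]. The first fact bounds [d] forward in time, the second
    backward. *)
Lemma gronwall F L x y s t : 0 <= L -> lipschitz_field F L -> solves F x -> solves F y ->
  s <= t ->
  let d r := \sum_(i < n) (x r i - y r i) ^+ 2 in
  d t <= d s * expR (2 * (L * n%:R) * (t - s)) /\
  d s <= d t * expR (2 * (L * n%:R) * (t - s)).
Proof.
move=> L0 FL sx sy st d; pose K := 2 * (L * n%:R).
pose dd r := \sum_(i < n) (2 * (x r i - y r i) * (F (x r) i - F (y r) i)).
have dE r : has_deriv d r (dd r).
  apply: derSum => i.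
  by apply: (der_eq (derX 1 (derD (sx r i) (derN (sy r i))))).
have ddK r : `|dd r| <= K * d r.
  apply: le_trans (ler_norm_sum _ _ _) _.
  apply: (@le_trans _ _ (\sum_(i < n) \sum_(j < n)
     (L * ((x r i - y r i) ^+ 2 + (x r j - y r j) ^+ 2)))).
    apply: ler_sum => i _; rewrite -mulr_sumr.
    rewrite normrM; apply: le_trans (ler_wpM2l _ (FL _ _ _)) _ => //.
    rewrite mulrCA ler_wpM2l // mulr_sumr; apply: ler_sum => j _.
    exact: ler_norm_sqr2.
  rewrite le_eqVlt; apply/orP; left; apply/eqP.
  under eq_bigr do under eq_bigr do rewrite mulrDr.
  under eq_bigr do rewrite big_split/= sumr_const card_ord -mulr_sumr.
  rewrite big_split/= sumr_const card_ord -/(d r).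
  under eq_bigr do rewrite -mulr_natl mulrCA.
  rewrite -!mulr_sumr -/(d r) -mulr_natl /K; ring.
have exE a : forall r, has_deriv (fun r => d r * expR (a * r)) r
    ((dd r + a * d r) * expR (a * r)).
  by move=> r; apply: (der_eq (derM (dE r) (der_expR_lin a r))) => //; ring.
split.
  have : - (d s * expR (- K * s)) <= - (d t * expR (- K * t)).
    apply: (nondecreasing_derive st (fun r _ => derN (exE (- K) r))) => r _.
    rewrite -mulNr mulr_ge0 ?expR_ge0//.
    by have := ddK r; rewrite ler_norml; lra.
  by rewrite lerN2 => /expR_transfer.
have h2 : d s * expR (K * s) <= d t * expR (K * t).
  apply: (nondecreasing_derive st (fun r _ => exE K r)) => r _.
  rewrite mulr_ge0 ?expR_ge0//.
  by have := ddK r; rewrite ler_norml; lra.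
have := @expR_transfer (d s) (d t) (- K) t s; rewrite opprK => /(_ h2).
by rewrite mulNr -mulrN opprB.
Qed.

Lemma ode_unique F L x y s : 0 <= L -> lipschitz_field F L -> solves F x -> solves F y ->
  (forall i, x s i = y s i) -> forall t i, x t i = y t i.
Proof.
move=> L0 FL sx sy xy t i.
have d0 : \sum_(j < n) (x s j - y s j) ^+ 2 = 0.
  by rewrite big1// => j _; rewrite xy subrr expr0n.
have : \sum_(j < n) (x t j - y t j) ^+ 2 <= 0.
  have [st|/ltW ts] := leP s t.
    by have [+ _] := gronwall L0 FL sx sy st; rewrite /= d0 mul0r.
  by have [_ +] := gronwall L0 FL sx sy ts; rewrite /= d0 mul0r.
move=> h; apply/eqP; rewrite -subr_eq0 -sqrf_eq0 eq_le sqr_ge0 andbT.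
by apply: le_trans h; rewrite (bigD1 i)//= lerDl sumr_ge0// => j _; rewrite sqr_ge0.
Qed.

End Ode.

(** * The potential below the first critical value *)

Section PotentialBounds.
Context {R : realType}.
Implicit Types (r s t x y mu k e : R).

(* U = - (1 - mu) tidal |q - E| - mu tidal |q - M| up to a constant. *)
Definition tidal x : R := x^-1 + x ^+ 2 / 2.

Lemma tidal_gt0 x : 0 < x -> 0 < tidal x.
Proof. by move=> x0; rewrite addr_gt0 ?invr_gt0// divr_gt0 ?exprn_gt0. Qed.

Lemma der_tidal (f : R -> R) x a : f x != 0 -> has_deriv f x a ->
  has_deriv (fun y => tidal (f y)) x ((f x - f x ^- 2) * a).
Proof.
move=> fx fa; apply: (der_eq (derD (derV fx fa) (derM (derX 1 fa) (derC 2^-1 x)))) => //.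
by field.
Qed.

Lemma cat_tidal (S : topologicalType) (f : S -> R) (p : S) : f p != 0 -> cont_at f p ->
  cont_at (fun p : S => tidal (f p)) p.
Proof.
move=> fx cf; apply: catD; first exact: catV.
by apply: catM; [exact: catX|exact: catC].
Qed.

Lemma tidal_decreasing x y : 0 < x -> x <= y -> y <= 1 -> tidal y <= tidal x.
Proof.
move=> x0 xy y1; have y0 : 0 < y by lra.
rewrite -subr_ge0.
have -> : tidal x - tidal y = (y - x) * (x^-1 * y^-1 - (x + y) / 2).
  by rewrite /tidal; field; rewrite !gt_eqF.
apply: mulr_ge0; first lra.
have y1' : 1 <= y^-1 by rewrite invf_ge1.
have x1' : 1 <= x^-1 by rewrite invf_ge1// (le_trans xy).
have : 1 <= x^-1 * y^-1 by rewrite -[1]mulr1 ler_pM.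
lra.
Qed.

Lemma tidal_increasing x y : 1 <= x -> x <= y -> tidal x <= tidal y.
Proof.
move=> x1 xy; have x0 : 0 < x by lra.
have y0 : 0 < y by lra.
rewrite -subr_ge0.
have -> : tidal y - tidal x = (y - x) * ((x + y) / 2 - x^-1 * y^-1).
  by rewrite /tidal; field; rewrite !gt_eqF.
apply: mulr_ge0; first lra.
have : x^-1 * y^-1 <= 1.
  by rewrite -invfM invf_le1 ?mulr_gt0//; nra.
lra.
Qed.

Lemma tidal_refl r : 0 <= r < 1 -> tidal (1 + r) <= tidal (1 - r).
Proof.
move=> /andP[r0 r1]; rewrite -subr_ge0.
have -> : tidal (1 - r) - tidal (1 + r) = 2 * r ^+ 3 / ((1 - r) * (1 + r)).
  by rewrite /tidal; field; rewrite !gt_eqF//; lra.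
by rewrite divr_ge0 ?mulr_ge0 ?exprn_ge0//; lra.
Qed.

(** Among the points at distance [r] from the earth the moon's term is largest at the one nearest to
    the moon: [tidal] falls up to 1, rises afterwards, and [tidal_refl] compares the two ends. *)
Lemma tidal_le r x : 0 <= r < 1 -> 1 - r <= x <= 1 + r -> tidal x <= tidal (1 - r).
Proof.
move=> r01 /andP[xl xr]; have [x1|/ltW x1] := leP x 1.
  by apply: tidal_decreasing => //; lra.
by apply: le_trans (tidal_refl r01); exact: tidal_increasing.
Qed.

(** [r] times the derivative of [tidal (1 - r)] in [r]; also the value of
    [(1 - x ^- 3) * (r ^+ 2 - r)] at [x = 1 - r]. *)
Definition tidal_pull r : R := r * ((1 - r) ^- 2 - (1 - r)).

Lemma tidal_pull_ge0 r : 0 <= r < 1 -> 0 <= tidal_pull r.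
Proof.
move=> /andP[r0 r1]; rewrite /tidal_pull mulr_ge0// subr_ge0.
have s0 : 0 < 1 - r by lra.
apply: (@le_trans _ _ 1); first lra.
by rewrite -exprVn exprn_ege1// invf_ge1//; lra.
Qed.

Lemma tidal_pull_mono r t : 0 <= r -> r <= t -> t < 1 ->
  tidal (1 - r) + tidal_pull r <= tidal (1 - t) + tidal_pull t.
Proof.
move=> r0 rt t1.
have E z : z < 1 -> tidal (1 - z) + tidal_pull z =
    (1 - z) ^- 2 - (1 - z) + 3 / 2 * (1 - z) ^+ 2.
  by move=> z1; rewrite /tidal /tidal_pull; field; rewrite gt_eqF// subr_gt0.
rewrite !E ?(le_lt_trans rt)//.
have : 1 - r <= 1 by lra.
have : 1 - t <= 1 - r by lra.
have : 0 < 1 - t by lra.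
move: (1 - t) (1 - r) => x y x0 xy y1; have y0 : 0 < y by lra.
rewrite -subr_ge0.
(* In the moon distances [x <= y <= 1] the second factor is at least [1 - (x + y) / 2], because
   [x ^- 2 * y ^- 2 >= 1]. *)
have -> : x ^- 2 - x + 3 / 2 * x ^+ 2 - (y ^- 2 - y + 3 / 2 * y ^+ 2) =
    (y - x) * ((x + y) * (x ^- 2 * y ^- 2 - 3 / 2) + 1).
  by field; rewrite !gt_eqF.
apply: mulr_ge0; first lra.
have h : 1 <= x ^- 2 * y ^- 2.
  by rewrite -!exprVn -exprMn exprn_ege1// -invfM invf_ge1 ?mulr_gt0//; nra.
have : 0 <= (x + y) * (x ^- 2 * y ^- 2 - 1) by rewrite mulr_ge0 ?subr_ge0//; lra.
lra.
Qed.

(** The right side is the left side at [x = 1 - r], [e = -1], the point between the two primaries.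
    When [e] and the side of [x] relative to 1 make the product nonpositive, [tidal_le] suffices.
    Otherwise the product is bounded by its value at the far end [x = 1 + r] for [e = 1], and at the
    near end [x = 1 - r] for [e = -1]. *)
Lemma tidal_shear r x e : 0 <= r < 1 -> 1 - r <= x <= 1 + r -> e = 1 \/ e = -1 ->
  tidal x + (1 - x ^- 3) * (r ^+ 2 + e * r) <= tidal (1 - r) + tidal_pull r.
Proof.
move=> r01 xr; have [r0 r1] := andP r01; have [x1 x2] := andP xr.
have x0 : 0 < x by lra.
have pull0 := tidal_pull_ge0 r01; have tx := tidal_le r01 xr.
have x3 : x <= 1 -> 1 <= x ^- 3.
  by move=> xle; rewrite invf_ge1 ?exprn_gt0// exprn_ile1// ltW.
have x3' : 1 <= x -> x ^- 3 <= 1.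
  by move=> xge; rewrite invf_le1 ?exprn_gt0// exprn_ege1.
case=> ->; have [xle|/ltW xge] := leP x 1.
- have : (1 - x ^- 3) * (r ^+ 2 + 1 * r) <= 0.
    by rewrite mulr_le0_ge0 ?subr_le0 ?x3// addr_ge0 ?mul1r ?sqr_ge0.
  lra.
- have y0 : 0 < 1 + r by lra.
  have s0 : 0 < 1 - r by lra.
  have h1 : (1 - x ^- 3) * (r ^+ 2 + 1 * r) <= (1 - (1 + r) ^- 3) * (r ^+ 2 + 1 * r).
    rewrite ler_wpM2r ?addr_ge0 ?mul1r ?sqr_ge0// lerD2l lerN2.
    by rewrite lef_pV2 ?posrE ?exprn_gt0// lerXn2r ?nnegrE// ltW.
  have h2 : tidal x <= tidal (1 + r) by exact: tidal_increasing.
  have h3 := tidal_refl r01.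
  have h4 : (1 - (1 + r) ^- 3) * (r ^+ 2 + 1 * r) <= tidal_pull r.
    rewrite -subr_ge0.
    have -> : tidal_pull r - (1 - (1 + r) ^- 3) * (r ^+ 2 + 1 * r) =
        r * ((1 - r) ^- 2 + (1 + r) ^- 2 - 2).
      by rewrite /tidal_pull; field; rewrite !gt_eqF.
    rewrite mulr_ge0// (_ : _ - 2 = ((1 - r)^-1 - (1 + r)^-1) ^+ 2 + 2 * (((1 - r) * (1 + r))^-1 - 1)); last first.
      by field; rewrite !gt_eqF.
    rewrite addr_ge0 ?sqr_ge0// mulr_ge0// subr_ge0 invf_ge1 ?mulr_gt0//.
    by have := sqr_ge0 r; nra.
  lra.
- have s0 : 0 < 1 - r by lra.
  have -> : tidal_pull r = (1 - (1 - r) ^- 3) * (r ^+ 2 + -1 * r).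
    by rewrite /tidal_pull; field; rewrite !gt_eqF.
  have h : x ^- 3 <= (1 - r) ^- 3.
    by rewrite lef_pV2 ?posrE ?exprn_gt0// lerXn2r ?nnegrE// ltW.
  have : 0 <= ((1 - r) ^- 3 - x ^- 3) * (r * (1 - r)).
    by rewrite mulr_ge0 ?subr_ge0// mulr_ge0// ltW.
  lra.
- have : (1 - x ^- 3) * (r ^+ 2 + -1 * r) <= 0.
    rewrite mulr_ge0_le0 ?subr_ge0 ?x3'//; nra.
  lra.
Qed.

(** Vanishing of the derivative of U along the segment of the primaries, at distance [t] from the
    earth and [1 - t] from the moon. *)
Definition critical_radius mu t :=
  (1 - mu) * (t ^- 2 - t) = mu * ((1 - t) ^- 2 - (1 - t)).

(** The expression is smallest at [r = t], [x = 1 - t], [e = -1]. There criticality turns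
    [mu * tidal_pull t] into [(1 - mu) * (t^-1 - t ^+ 2)], and what remains is exactly the gap [k -
    (1 - mu) * tidal t - mu * tidal (1 - t)]. *)
Lemma gradient_factor_gt0 mu k t r x e : 0 < mu < 1 -> 0 < t < 1 ->
  critical_radius mu t -> (1 - mu) * tidal t + mu * tidal (1 - t) < k ->
  0 <= r <= t -> 1 - r <= x <= 1 + r -> e = 1 \/ e = -1 ->
  0 < k - 3 / 2 * (1 - mu) * r ^+ 2
      - mu * (tidal x + (1 - x ^- 3) * (r ^+ 2 + e * r)).
Proof.
move=> /andP[mu0 mu1] /andP[t0 t1] crit kt /andP[r0 rt] xr He.
have r01 : 0 <= r < 1 by lra.
have h1 := tidal_shear r01 xr He; have h2 := tidal_pull_mono r0 rt t1.
have h3 : mu * (tidal x + (1 - x ^- 3) * (r ^+ 2 + e * r)) <=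
          mu * (tidal (1 - t) + tidal_pull t).
  by rewrite ler_pM2l// (le_trans h1).
have h4 : mu * tidal_pull t = (1 - mu) * (t^-1 - t ^+ 2).
  rewrite /tidal_pull mulrCA -[mu * _]crit.
  by field; rewrite gt_eqF.
have h5 : (1 - mu) * r ^+ 2 <= (1 - mu) * t ^+ 2.
  by rewrite ler_wpM2l ?subr_ge0 ?(ltW mu1)// ler_sqr ?nnegrE// ltW.
move: kt h3; rewrite {1}/tidal (mulrDr mu (tidal (1 - t))) h4; lra.
Qed.

(** On the circle of radius [t] around the earth the potential is smallest at the critical point,
    where it still exceeds the energy. *)
Lemma potential_barrier mu k t x : 0 < mu < 1 -> 0 < t < 1 ->
  (1 - mu) * tidal t + mu * tidal (1 - t) < k -> 1 - t <= x <= 1 + t ->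
  0 < k - (1 - mu) * tidal t - mu * tidal x.
Proof.
move=> /andP[mu0 mu1] /andP[t0 t1] kt xt.
have : mu * tidal x <= mu * tidal (1 - t) by rewrite ler_pM2l// tidal_le//; lra.
lra.
Qed.

End PotentialBounds.

(** * Levi-Civita coordinates *)

Section LeviCivita.
Context {R : realType}.
Variables (mu k t : R).
Hypotheses (mu01 : 0 < mu < 1) (t01 : 0 < t < 1) (crit : critical_radius mu t).
Hypothesis kt : (1 - mu) * tidal t + mu * tidal (1 - t) < k.
Implicit Types (x y u w a b s : R).

(* (u, w) is a Levi-Civita coordinate: q - earth = (u + i w)^2, so that |q - earth| = sqnorm u w
   and |q - moon| = moon_dist u w. *)
Definition sqnorm u w : R := u ^+ 2 + w ^+ 2.

Definition moon_dist u w : R := Num.sqrt ((1 + u ^+ 2 - w ^+ 2) ^+ 2 + (2 * u * w) ^+ 2).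

(** This is [r (U - c)] for [k = mu (1 - mu) / 2 - c], multiplied out so that it is regular at the
    collision [r = 0], with value [- (1 - mu)] there. *)
Definition lc_potential u w : R :=
  sqnorm u w * (k - mu * tidal (moon_dist u w)) - (1 - mu) * (1 + sqnorm u w ^+ 3 / 2).

(* r (U - c) has gradient (2 u lc_slope 1, 2 w lc_slope (-1)), see [der_lc_potential]; the point
   of the Levi-Civita coordinates is that both slopes are positive in the Hill's region. *)
Definition lc_slope e u w : R :=
  k - 3 / 2 * (1 - mu) * sqnorm u w ^+ 2 -
  mu * (tidal (moon_dist u w)
        + (1 - moon_dist u w ^- 3) * (sqnorm u w ^+ 2 + e * sqnorm u w)).

Lemma sqnorm_ge0 u w : 0 <= sqnorm u w.
Proof. by rewrite addr_ge0 ?sqr_ge0. Qed.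

Lemma moon_dist_bounds u w : sqnorm u w <= 1 ->
  1 - sqnorm u w <= moon_dist u w <= 1 + sqnorm u w.
Proof.
move=> r1; have r0 := sqnorm_ge0 u w.
have h1 : 0 <= 1 - sqnorm u w by lra.
have h2 : 0 <= 1 + sqnorm u w by lra.
rewrite -(ger0_norm h1) -(ger0_norm h2) -!sqrtr_sqr !ler_wsqrtr// /sqnorm.
  by have := sqr_ge0 w; lra.
by have := sqr_ge0 u; lra.
Qed.

Lemma moon_dist_gt0 u w : w ^+ 2 < 1 -> 0 < moon_dist u w.
Proof.
move=> w1; rewrite sqrtr_gt0 ltr_wpDr ?sqr_ge0// exprn_gt0//.
by have := sqr_ge0 u; lra.
Qed.

Lemma lc_slope_gt0 e u w : sqnorm u w <= t -> e = 1 \/ e = -1 -> 0 < lc_slope e u w.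
Proof.
move=> rt He; apply: (gradient_factor_gt0 mu01 t01 crit kt) => //.
  by rewrite sqnorm_ge0.
by apply: moon_dist_bounds; case/andP: t01 => _; lra.
Qed.

Lemma lc_potential_gt0 u w : sqnorm u w = t -> 0 < lc_potential u w.
Proof.
move=> rt; have /andP[t0 t1] := t01.
have : 1 - t <= moon_dist u w <= 1 + t by rewrite -rt moon_dist_bounds// rt ltW.
move=> /(potential_barrier mu01 t01 kt) h.
have -> : lc_potential u w = t * (k - (1 - mu) * tidal t - mu * tidal (moon_dist u w)).
  by rewrite /lc_potential rt /tidal; field; rewrite !gt_eqF// moon_dist_gt0//;
     move: rt; rewrite /sqnorm; have := sqr_ge0 u; lra.
exact: mulr_gt0.
Qed.

(** Stated along a curve, the form in which both conservation of energy and monotonicity along rays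
    from the earth apply it. *)
Lemma der_lc_potential (u w : R -> R) s a b : w s ^+ 2 < 1 ->
  has_deriv u s a -> has_deriv w s b ->
  has_deriv (fun s => lc_potential (u s) (w s)) s
    (2 * u s * lc_slope 1 (u s) (w s) * a + 2 * w s * lc_slope (-1) (u s) (w s) * b).
Proof.
move=> ws du dw; have d0 := moon_dist_gt0 (u s) ws.
have dX := derD (derD (derC 1 s) (derX 1 du)) (derN (derX 1 dw)).
have dY := derM (derM (derC 2 s) du) dw.
have dD := derD (derX 1 dX) (derX 1 dY).
have dd : has_deriv (fun s => moon_dist (u s) (w s)) s
   (((1 + u s ^+ 2 - w s ^+ 2) * (2 * u s * a - 2 * w s * b) +
     2 * u s * w s * (2 * a * w s + 2 * u s * b)) / moon_dist (u s) (w s)).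
  apply: (der_eq (derSqrt _ dD)) => //; last first.
    rewrite -/(moon_dist (u s) (w s)) !expr1; field.
    by rewrite gt_eqF.
  by move: d0; rewrite sqrtr_gt0.
have dr : has_deriv (fun s => sqnorm (u s) (w s)) s (2 * u s * a + 2 * w s * b).
  by apply: (der_eq (derD (derX 1 du) (derX 1 dw))).
have d0' : moon_dist (u s) (w s) != 0 by rewrite gt_eqF.
have dT := derD (derV (f := fun s => moon_dist (u s) (w s)) d0' dd) (derM (derX 1 dd) (derC 2^-1 s)).
apply: (der_eq (derD (derM dr (derD (derC k s) (derN (derM (derC mu s) dT))))
   (derN (derM (derC (1 - mu) s) (derD (derC 1 s) (derM (derX 2 dr) (derC 2^-1 s))))))) => //.
rewrite /lc_slope /tidal /sqnorm; move: (moon_dist (u s) (w s)) d0' => d d0'.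
by field.
Qed.

End LeviCivita.

(** * Bounded Lipschitz functions and truncation *)

Section BoundedLipschitz.
Context {R : realType} {n : nat}.
Notation state := ('I_n -> R).
Implicit Types (f g : state -> R) (v w : state) (B d M L : R).

(** Boundedness is included because it makes the class stable under products, so that the vector
    field can be checked term by term. *)
Definition bounded_lipschitz f := exists M L, [/\ 0 <= L, forall v, `|f v| <= M
  & forall v w, `|f v - f w| <= L * \sum_(j < n) `|v j - w j|].

Lemma blC (c : R) : bounded_lipschitz (fun=> c).
Proof. by exists `|c|, 0; split=> // v w; rewrite subrr normr0 mul0r. Qed.

Lemma blD f g : bounded_lipschitz f -> bounded_lipschitz g ->
  bounded_lipschitz (fun v => f v + g v).
Proof.
move=> [M [L [L0 fM fL]]] [M' [L' [L0' gM gL]]]; exists (M + M'), (L + L'); split.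
- exact: addr_ge0.
- by move=> v; apply: le_trans (ler_normD _ _) _; exact: lerD.
- move=> v w; rewrite opprD addrACA mulrDl.
  by apply: le_trans (ler_normD _ _) _; exact: lerD.
Qed.

Lemma blM f g : bounded_lipschitz f -> bounded_lipschitz g ->
  bounded_lipschitz (fun v => f v * g v).
Proof.
move=> [M [L [L0 fM fL]]] [M' [L' [L0' gM gL]]].
exists (M * M'), (`|M| * L' + `|M'| * L); split.
- by rewrite addr_ge0 ?mulr_ge0.
- by move=> v; rewrite normrM ler_pM.
- move=> v w; have -> : f v * g v - f w * g w = f v * (g v - g w) + g w * (f v - f w) by ring.
  rewrite mulrDl -!mulrA; apply: le_trans (ler_normD _ _) _; rewrite !normrM.
  by apply: lerD; apply: ler_pM => //; [apply: le_trans (fM v) _|apply: le_trans (gM w) _];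
    exact: ler_norm.
Qed.

Lemma blN f : bounded_lipschitz f -> bounded_lipschitz (fun v => - f v).
Proof.
move=> [M [L [L0 fM fL]]]; exists M, L; split => // [v|v w]; first by rewrite normrN.
by rewrite -opprD normrN.
Qed.

Lemma blX f m : bounded_lipschitz f -> bounded_lipschitz (fun v => f v ^+ m).
Proof.
move=> fb; elim: m => [|m IH]; first exact: blC.
by under eq_fun do rewrite exprS; exact: blM.
Qed.

Lemma blV f d : 0 < d -> (forall v, d <= f v) -> bounded_lipschitz f ->
  bounded_lipschitz (fun v => (f v)^-1).
Proof.
move=> d0 fd [M [L [L0 fM fL]]].
have f0 v : 0 < f v by exact: lt_le_trans (fd v).
have fVd v : (f v)^-1 <= d^-1 by rewrite lef_pV2 ?posrE.
exists d^-1, (d^-1 * d^-1 * L); split.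
- by rewrite !mulr_ge0 ?invr_ge0 ?(ltW d0).
- by move=> v; rewrite ger0_norm ?invr_ge0 ?(ltW (f0 _)).
- move=> v w; have -> : (f v)^-1 - (f w)^-1 = (f v)^-1 * (f w)^-1 * (f w - f v).
    by field; rewrite !gt_eqF.
  rewrite normrM -[leRHS]mulrA ger0_norm ?mulr_ge0 ?invr_ge0 ?(ltW (f0 _))//.
  by rewrite ler_pM ?mulr_ge0 ?ler_pM ?invr_ge0 ?(ltW (f0 _))// distrC.
Qed.

Lemma bl_sqrt f d : 0 < d -> (forall v, d <= f v) -> bounded_lipschitz f ->
  bounded_lipschitz (fun v => Num.sqrt (f v)).
Proof.
move=> d0 fd [M [L [L0 fM fL]]].
have f0 v : 0 < f v by exact: lt_le_trans (fd v).
have s0 v : 0 < Num.sqrt (f v) by rewrite sqrtr_gt0.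
have sd : 0 < Num.sqrt d by rewrite sqrtr_gt0.
have fs v : Num.sqrt d <= Num.sqrt (f v) by rewrite ler_wsqrtr.
exists (Num.sqrt M), ((Num.sqrt d)^-1 * L); split.
- by rewrite mulr_ge0 ?invr_ge0 ?(ltW sd).
- move=> v; rewrite ger0_norm ?sqrtr_ge0// ler_wsqrtr//.
  by apply: le_trans (fM v); exact: ler_norm.
- move=> v w.
  have E : f v - f w = (Num.sqrt (f v) - Num.sqrt (f w)) * (Num.sqrt (f v) + Num.sqrt (f w)).
    by rewrite -subr_sqr !sqr_sqrtr ?(ltW (f0 _)).
  have := fL v w; rewrite E normrM.
  rewrite [X in _ * X <= _]ger0_norm ?addr_ge0 ?sqrtr_ge0// => h.
  rewrite -mulrA ler_pdivlMl//; apply: le_trans h; rewrite mulrC ler_wpM2l//.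
  by apply: le_trans (fs v) _; rewrite lerDl (ltW (s0 _)).
Qed.

Definition clamp B (x : R) : R := if x < - B then - B else if B < x then B else x.

Lemma clamp_norm B x : 0 <= B -> `|clamp B x| <= B.
Proof.
by move=> B0; rewrite ler_norml /clamp; case: (ltP x (- B)) => ?; [|case: (ltP B x) => ?]; lra.
Qed.

Lemma clamp_id B x : `|x| <= B -> clamp B x = x.
Proof.
by rewrite ler_norml /clamp; case: (ltP x (- B)) => ?; [|case: (ltP B x) => ?]; lra.
Qed.

Lemma clampN B x : 0 <= B -> clamp B (- x) = - clamp B x.
Proof.
move=> B0; rewrite /clamp; case: (ltP x (- B)) => ?; case: (ltP B x) => ?;
  case: (ltP (- x) (- B)) => ?; case: (ltP B (- x)) => ?; lra.
Qed.

Lemma bl_clamp B i : 0 <= B -> bounded_lipschitz (fun v => clamp B (v i)).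
Proof.
move=> B0; exists B, 1; split => // [v|v w]; first exact: clamp_norm.
rewrite mul1r (bigD1 i)//= (@le_trans _ _ `|v i - w i|)//; last first.
  by rewrite lerDl sumr_ge0.
move: (v i) (w i) => x y; rewrite /clamp; case: (ltP x (- B)) => ?; case: (ltP B x) => ?;
  case: (ltP y (- B)) => ?; case: (ltP B y) => ?; rewrite ler_norml;
  case: (ler0P (x - y)) => ?; lra.
Qed.

Lemma bounded_lipschitz_field m (F : state -> 'I_m -> R) :
  (forall i, bounded_lipschitz (fun v => F v i)) ->
  exists M L, [/\ 0 <= L, forall v i, `|F v i| <= M
    & forall v w i, `|F v i - F w i| <= L * \sum_(j < n) `|v j - w j|].
Proof.
move=> /choice[M /choice[L HL]].
exists (\sum_i `|M i|), (\sum_i L i); split.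
- by apply: sumr_ge0 => i _; case: (HL i).
- move=> v i; have [_ + _] := HL i => /(_ v) /le_trans; apply.
  by rewrite (bigD1 i)//= (le_trans (ler_norm _))// lerDl sumr_ge0.
- move=> v w i; have [_ _ +] := HL i => /(_ v w) /le_trans; apply.
  rewrite ler_wpM2r ?sumr_ge0// (bigD1 i)//= lerDl sumr_ge0// => j _.
  by case: (HL j).
Qed.

End BoundedLipschitz.

(** * The truncated Levi-Civita flow *)

Section ClampedFlow.
Context {R : realType}.
Variables (mu k t V : R).
Hypotheses (mu01 : 0 < mu < 1) (t01 : 0 < t < 1) (crit : critical_radius mu t).
Hypothesis kt : (1 - mu) * tidal t + mu * tidal (1 - t) < k.
Hypothesis V0 : 0 <= V.
Implicit Types (x y u w a b s : R).

Definition acc_u u w b : R := - (u / 2) * lc_slope mu k 1 u w + 2 * sqnorm u w * b.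
Definition acc_w u w a : R := - (w / 2) * lc_slope mu k (-1) u w - 2 * sqnorm u w * a.

(* The equations of motion on the level set H = c, in the time s with dt = r ds. *)
Definition lc_solution (u w a b : R -> R) := forall s,
  [/\ has_deriv u s (a s), has_deriv w s (b s),
      has_deriv a s (acc_u (u s) (w s) (b s)) & has_deriv b s (acc_w (u s) (w s) (a s))].

Let cp := clamp (Num.sqrt t).
Let cv := clamp V.

(* Truncating positions and velocities makes the field bounded and globally Lipschitz; by
   conservation of energy the truncation is never active on the orbits considered below. *)
Definition clamped_solution (u w a b : R -> R) := forall s,
  [/\ has_deriv u s (cv (a s)), has_deriv w s (cv (b s)),
      has_deriv a s (acc_u (cp (u s)) (cp (w s)) (cv (b s)))
    & has_deriv b s (acc_w (cp (u s)) (cp (w s)) (cv (a s)))].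

Let i0 : 'I_4 := @Ordinal 4 0 isT.
Let i1 : 'I_4 := @Ordinal 4 1 isT.
Let i2 : 'I_4 := @Ordinal 4 2 isT.
Let i3 : 'I_4 := @Ordinal 4 3 isT.

Let field (v : 'I_4 -> R) (i : 'I_4) : R :=
  [:: cv (v i2); cv (v i3); acc_u (cp (v i0)) (cp (v i1)) (cv (v i3));
      acc_w (cp (v i0)) (cp (v i1)) (cv (v i2))]`_i.

Let pack (u w a b : R -> R) s (i : 'I_4) : R := [:: u s; w s; a s; b s]`_i.

Let pack_solves (u w a b : R -> R) : clamped_solution u w a b -> solves field (pack u w a b).
Proof. by move=> sol s; case=> [[|[|[|[|//]]]] ?]; case: (sol s). Qed.

Lemma clamp_sqrt_sqr x : clamp (Num.sqrt t) x ^+ 2 <= t.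
Proof.
have := @clamp_norm R (Num.sqrt t) x (sqrtr_ge0 _); move: t01 => /andP[t0 t1].
move=> h; rewrite -[leRHS](sqr_sqrtr (ltW t0)) -(real_normK (num_real (clamp _ _))).
by rewrite ler_sqr ?nnegrE ?sqrtr_ge0.
Qed.

Let field_bl : exists M L, [/\ 0 <= L, forall v i, `|field v i| <= M
    & forall (v w : 'I_4 -> R) i, `|field v i - field w i| <= L * \sum_(j < 4) `|v j - w j|].
Proof.
have sp : 0 <= Num.sqrt t by exact: sqrtr_ge0.
have [t0 t1] := andP t01.
have bu : bounded_lipschitz (fun v : 'I_4 -> R => cp (v i0)) by exact: bl_clamp.
have bw : bounded_lipschitz (fun v : 'I_4 -> R => cp (v i1)) by exact: bl_clamp.
have ba : bounded_lipschitz (fun v : 'I_4 -> R => cv (v i2)) by exact: bl_clamp.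
have bb : bounded_lipschitz (fun v : 'I_4 -> R => cv (v i3)) by exact: bl_clamp.
have br := blD (blX 2 bu) (blX 2 bw).
have bd2 := blD (blX 2 (blD (blD (blC 1) (blX 2 bu)) (blN (blX 2 bw))))
  (blX 2 (blM (blM (blC 2) bu) bw)).
(* Truncated positions satisfy [w ^+ 2 <= t], so the moon stays at distance at least [1 - t] and its
   inverse powers are bounded and Lipschitz. *)
have d2 v : (1 - t) ^+ 2 <= (1 + cp (v i0) ^+ 2 - cp (v i1) ^+ 2) ^+ 2
    + (2 * cp (v i0) * cp (v i1)) ^+ 2.
  apply: ler_wpDr; first exact: sqr_ge0.
  have h1 : cp (v i1) ^+ 2 <= t by exact: clamp_sqrt_sqr.
  have h0 := sqr_ge0 (cp (v i0)).
  by rewrite ler_sqr ?nnegrE; lra.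
have e1 : 0 < 1 - t by rewrite subr_gt0.
have e0 : 0 < (1 - t) ^+ 2 by rewrite exprn_gt0// subr_gt0.
have bd := bl_sqrt e0 d2 bd2.
have dd v : 1 - t <= moon_dist (cp (v i0)) (cp (v i1)).
  rewrite -(ger0_norm (ltW e1)) -sqrtr_sqr ler_wsqrtr//; exact: d2.
have bV := blV e1 dd bd.
have d3 v : (1 - t) ^+ 3 <= moon_dist (cp (v i0)) (cp (v i1)) ^+ 3.
  by rewrite lerXn2r ?nnegrE ?sqrtr_ge0 ?(ltW e1).
have e3 : 0 < (1 - t) ^+ 3 by rewrite exprn_gt0.
have bV3 := blV e3 d3 (blX 3 bd).
have bT := blD bV (blM (blX 2 bd) (blC 2^-1)).
have bS e := blD (blD (blC k) (blN (blM (blC (3 / 2 * (1 - mu))) (blX 2 br))))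
  (blN (blM (blC mu) (blD bT (blM (blD (blC 1) (blN bV3)) (blD (blX 2 br) (blM (blC e) br)))))).
apply: bounded_lipschitz_field => -[[|[|[|[|//]]]] ?] //=.
- exact: blD (blM (blN (blM bu (blC 2^-1))) (bS 1)) (blM (blM (blC 2) br) bb).
- exact: blD (blM (blN (blM bw (blC 2^-1))) (bS (-1))) (blN (blM (blM (blC 2) br) ba)).
Qed.

Lemma clamped_exists u0 w0 a0 b0 : exists u w a b : R -> R,
  clamped_solution u w a b /\ [/\ u 0 = u0, w 0 = w0, a 0 = a0 & b 0 = b0].
Proof.
have [M [L [L0 FM FL]]] := field_bl.
have [x [x0 sx]] := picard_lindelof L0 FL FM (fun i => [:: u0; w0; a0; b0]`_i).
exists (fun s => x s i0), (fun s => x s i1), (fun s => x s i2), (fun s => x s i3).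
split; last by split; rewrite x0.
by move=> s; split; [exact: (sx s i0)|exact: (sx s i1)|exact: (sx s i2)|exact: (sx s i3)].
Qed.

Lemma clamped_unique (u w a b u' w' a' b' : R -> R) s0 :
  clamped_solution u w a b -> clamped_solution u' w' a' b' ->
  [/\ u s0 = u' s0, w s0 = w' s0, a s0 = a' s0 & b s0 = b' s0] ->
  forall s, [/\ u s = u' s, w s = w' s, a s = a' s & b s = b' s].
Proof.
move=> /pack_solves sx /pack_solves sy [hu hw ha hb] s.
have [M [L [L0 _ FL]]] := field_bl.
have h := ode_unique L0 FL sx sy (s := s0).
have {}h : forall i, pack u w a b s i = pack u' w' a' b' s i.
  by apply: h => -[[|[|[|[|//]]]] ?].
by split; [exact: (h i0)|exact: (h i1)|exact: (h i2)|exact: (h i3)].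
Qed.

Lemma clamped_dependence : exists K, forall (u w a b u' w' a' b' : R -> R) s,
  clamped_solution u w a b -> clamped_solution u' w' a' b' -> 0 <= s ->
  (u s - u' s) ^+ 2 + (w s - w' s) ^+ 2 + (a s - a' s) ^+ 2 + (b s - b' s) ^+ 2 <=
  ((u 0 - u' 0) ^+ 2 + (w 0 - w' 0) ^+ 2 + (a 0 - a' 0) ^+ 2 + (b 0 - b' 0) ^+ 2)
  * expR (K * s).
Proof.
have [M [L [L0 _ FL]]] := field_bl.
exists (2 * (L * 4)) => u w a b u' w' a' b' s /pack_solves sx /pack_solves sy s0.
have [+ _] := gronwall L0 FL sx sy s0.
by rewrite /= !big_ord_recl !big_ord0 /= !addr0 !addrA subr0.
Qed.

End ClampedFlow.

(** * Invariance of the disc on the zero energy level *)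

Section Invariance.
Context {R : realType}.
Variables (mu k t : R).
Hypotheses (mu01 : 0 < mu < 1) (t01 : 0 < t < 1) (crit : critical_radius mu t).
Hypothesis kt : (1 - mu) * tidal t + mu * tidal (1 - t) < k.
Implicit Types (x y s : R) (u w a b : R -> R).

(** In the disc - W is at most [tidal (1 - t) + 3 / 2], which is less than [2 * speed_bound ^+ 2];
    on the level [2 |z'|^2 + W = 0] the speed therefore stays strictly below this constant. *)
Definition speed_bound : R := tidal (1 - t) + 3.

Lemma speed_bound_ge3 : 3 <= speed_bound.
Proof.
have [t0 t1] := andP t01; rewrite /speed_bound lerDr addr_ge0//.
  by rewrite invr_ge0 subr_ge0 ltW.
by rewrite mulr_ge0 ?sqr_ge0// invr_ge0.
Qed.

Lemma kinetic_bound x y : sqnorm x y <= t ->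
  - lc_potential mu k x y < 2 * speed_bound ^+ 2.
Proof.
move=> rt; have [t0 t1] := andP t01; have [mu0 mu1] := andP mu01.
have r0 := sqnorm_ge0 x y; have V3 := speed_bound_ge3.
have r01 : 0 <= sqnorm x y < 1 by lra.
have : tidal (moon_dist x y) <= tidal (1 - t).
  apply: tidal_le; first by rewrite ltW.
  have := @moon_dist_bounds R x y; rewrite (le_trans rt (ltW t1)) => /(_ isT); lra.
move=> dt.
have k0 : 0 < k.
  apply: le_lt_trans kt; rewrite addr_ge0// mulr_ge0 ?(ltW mu0) ?subr_ge0 ?(ltW mu1)//.
    by rewrite ltW// tidal_gt0.
  by rewrite ltW// tidal_gt0// subr_gt0.
have e0 : 0 <= tidal (1 - t) by move: V3; rewrite /speed_bound; lra.
have h1 : sqnorm x y * (mu * tidal (moon_dist x y)) <= tidal (1 - t).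
  apply: (@le_trans _ _ (sqnorm x y * (mu * tidal (1 - t)))).
    by rewrite ler_wpM2l// ler_pM2l.
  by rewrite mulrA ler_piMl// mulr_ile1 ?(ltW mu0) ?(ltW mu1)//; lra.
have h2' : 0 <= sqnorm x y ^+ 3 by rewrite exprn_ge0.
have h2 : sqnorm x y ^+ 3 <= 1 by rewrite exprn_ile1// ltW//; case/andP: r01.
have h3 : 0 <= sqnorm x y * k by rewrite mulr_ge0// ltW.
have h4 : (1 - mu) * (1 + sqnorm x y ^+ 3 / 2) <= 1 * (3 / 2).
  by apply: ler_pM; lra.
have h5 : 3 * speed_bound <= speed_bound ^+ 2 by rewrite expr2 ler_wpM2r//; lra.
rewrite /lc_potential mulrBr; rewrite /speed_bound in h5 V3 *; lra.
Qed.

Notation clamped := (clamped_solution mu k t speed_bound).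

Definition energy u w a b s : R :=
  2 * (a s ^+ 2 + b s ^+ 2) + lc_potential mu k (u s) (w s).

(** Up to the first time [T] at which one of the two bounds is attained the truncation is inactive,
    so energy is conserved on [0, T]. At [T] zero energy makes both inequalities strict again: W > 0
    on the circle [sqnorm = t] excludes the first equality, [kinetic_bound] the second. *)
Lemma clamped_invariant u w a b : clamped u w a b ->
  sqnorm (u 0) (w 0) < t -> energy u w a b 0 = 0 ->
  forall s, 0 <= s -> [/\ sqnorm (u s) (w s) < t, a s ^+ 2 + b s ^+ 2 < speed_bound ^+ 2
    & energy u w a b s = 0].
Proof.
move=> sol r0 E0; have [t0 t1] := andP t01.
have V0 : 0 <= speed_bound by have := speed_bound_ge3; lra.
have du s : has_deriv u s (clamp speed_bound (a s)) by case: (sol s).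
have dw s : has_deriv w s (clamp speed_bound (b s)) by case: (sol s).
have da s : has_deriv a s (acc_u mu k (clamp (Num.sqrt t) (u s)) (clamp (Num.sqrt t) (w s))
    (clamp speed_bound (b s))) by case: (sol s).
have db s : has_deriv b s (acc_w mu k (clamp (Num.sqrt t) (u s)) (clamp (Num.sqrt t) (w s))
    (clamp speed_bound (a s))) by case: (sol s).
pose hr s := sqnorm (u s) (w s) - t.
pose hv s := a s ^+ 2 + b s ^+ 2 - speed_bound ^+ 2.
have chr : continuous hr.
  by move=> s; exact: der_cont (derD (derD (derX 1 (du s)) (derX 1 (dw s))) (derC (- t) s)).
have chv : continuous hv.
  by move=> s; exact: der_cont (derD (derD (derX 1 (da s)) (derX 1 (db s))) (derC _ s)).
have conserved T : 0 <= T -> (forall r, 0 <= r <= T -> hr r <= 0 /\ hv r <= 0) ->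
    energy u w a b T = 0.
  move=> T0 good; rewrite -E0; symmetry; apply: constant_derive => // s sT.
  have [g1 g2] := good s sT.
  have ru : u s ^+ 2 <= t by move: g1; rewrite /hr /sqnorm; have := sqr_ge0 (w s); lra.
  have rw : w s ^+ 2 <= t by move: g1; rewrite /hr /sqnorm; have := sqr_ge0 (u s); lra.
  have va : a s ^+ 2 <= speed_bound ^+ 2 by move: g2; rewrite /hv; have := sqr_ge0 (b s); lra.
  have vb : b s ^+ 2 <= speed_bound ^+ 2 by move: g2; rewrite /hv; have := sqr_ge0 (a s); lra.
  have Ea : clamp speed_bound (a s) = a s by rewrite clamp_id ?norm_le_of_sqr.
  have Eb : clamp speed_bound (b s) = b s by rewrite clamp_id ?norm_le_of_sqr.
  have Eu : clamp (Num.sqrt t) (u s) = u s.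
    by rewrite clamp_id ?norm_le_of_sqr ?sqrtr_ge0// sqr_sqrtr// ltW.
  have Ew : clamp (Num.sqrt t) (w s) = w s.
    by rewrite clamp_id ?norm_le_of_sqr ?sqrtr_ge0// sqr_sqrtr// ltW.
  have := du s; have := dw s; have := da s; have := db s; rewrite Ea Eb Eu Ew.
  move=> db' da' dw' du'.
  apply: (der_eq (derD (derM (derC 2 s) (derD (derX 1 da') (derX 1 db')))
    (der_lc_potential mu k _ du' dw'))) => //.
    exact: le_lt_trans t1.
  by rewrite /acc_u /acc_w; field.
have step T : 0 <= T -> hr T <= 0 -> hv T <= 0 -> energy u w a b T = 0 ->
    hr T < 0 /\ hv T < 0.
  move=> T0; rewrite {1}/hr subr_le0 => rT vT ET.
  have := kinetic_bound rT; move: ET; rewrite /energy => ET kT.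
  have hvT : hv T < 0 by rewrite /hv; lra.
  split => //; rewrite /hr subr_lt0 lt_neqAle rT andbT; apply/eqP => rt.
  have := lc_potential_gt0 mu01 t01 kt rt.
  by have := sqr_ge0 (a T); have := sqr_ge0 (b T); lra.
pose h s := Num.max (hr s) (hv s).
have ch : continuous h by move=> s; apply: continuous_max; [exact: chr|exact: chv].
have h0 : h 0 < 0.
  have r0' : hr 0 <= 0 by rewrite /hr; lra.
  have : - lc_potential mu k (u 0) (w 0) < 2 * speed_bound ^+ 2 by apply: kinetic_bound; exact: ltW.
  by move: E0; rewrite /energy /h gt_max /hr /hv => E0 kb; apply/andP; split; lra.
have hneg s : 0 <= s -> h s < 0.
  move=> s0; rewrite ltNge; apply/negP => hs.
  have [T [/andP[T0 Ts] hT hlt]] := first_zero ch s0 h0 hs.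
  have g1 r : 0 <= r <= T -> hr r <= 0.
    by apply: nonpos_limit => // x /hlt; rewrite gt_max => /andP[].
  have g2 r : 0 <= r <= T -> hv r <= 0.
    by apply: nonpos_limit => // x /hlt; rewrite gt_max => /andP[].
  have T00 := ltW T0.
  have TT : 0 <= T <= T by rewrite T00 lexx.
  have ET : energy u w a b T = 0 by apply: conserved => // r rT; split; [exact: g1|exact: g2].
  have [q1 q2] := step T T00 (g1 _ TT) (g2 _ TT) ET.
  by have : h T < 0; [rewrite gt_max q1|rewrite hT ltxx].
move=> s s0; have := hneg s s0; rewrite gt_max => /andP[q1 q2].
split; [by move: q1; rewrite /hr; lra|by move: q2; rewrite /hv; lra|].
apply: conserved => // r /andP[r1 _]; have := hneg r r1; rewrite gt_max => /andP[p1 p2].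
by rewrite !ltW.
Qed.

End Invariance.

(** * Shooting *)

Section Shooting.
Context {R : realType}.
Variables (mu k t : R).
Hypotheses (mu01 : 0 < mu < 1) (t01 : 0 < t < 1) (crit : critical_radius mu t).
Hypothesis kt : (1 - mu) * tidal t + mu * tidal (1 - t) < k.
Implicit Types (x y s : R) (u w a b : R -> R).

Notation V := (speed_bound t).
Notation clamped := (clamped_solution mu k t V).

Let t0 : 0 < t. Proof. by case/andP: t01. Qed.
Let t1 : t < 1. Proof. by case/andP: t01. Qed.
Let V0 : 0 <= V. Proof. by have := speed_bound_ge3 t01; lra. Qed.

Lemma lc_slopeNw e x y : lc_slope mu k e x (- y) = lc_slope mu k e x y.
Proof. by rewrite /lc_slope /moon_dist /sqnorm mulrN !sqrrN. Qed.

Lemma lc_slopeNu e x y : lc_slope mu k e (- x) y = lc_slope mu k e x y.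
Proof. by rewrite /lc_slope /moon_dist /sqnorm mulrN mulNr !sqrrN. Qed.

(** A reflection alone would reverse the Coriolis term; combined with time reversal it is a
    symmetry. [clamped_mirror] is the same for the other axis, reversing time about [c / 2]. *)
Lemma clamped_reverse u w a b : clamped u w a b ->
  clamped (fun s => u (- s)) (fun s => - w (- s)) (fun s => - a (- s)) (fun s => b (- s)).
Proof.
move=> sol s; have [/der_flip du /der_flip dw /der_flip da /der_flip db] := sol (- s).
have sp : 0 <= Num.sqrt t by exact: sqrtr_ge0.
split.
- by rewrite clampN.
- by apply: (der_eq (derN dw)) => //; rewrite opprK.
- apply: (der_eq (derN da)) => //; rewrite opprK clampN// /acc_u lc_slopeNw.
  by rewrite /sqnorm sqrrN.
- apply: (der_eq db) => //; rewrite !clampN// /acc_w lc_slopeNw /sqnorm sqrrN.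
  by ring.
Qed.

Lemma clamped_mirror c u w a b : clamped u w a b ->
  clamped (fun s => - u (c - s)) (fun s => w (c - s)) (fun s => a (c - s)) (fun s => - b (c - s)).
Proof.
move=> sol s; have := sol (c - s).
move=> [/der_reflect du /der_reflect dw /der_reflect da /der_reflect db].
have sp : 0 <= Num.sqrt t by exact: sqrtr_ge0.
split.
- by apply: (der_eq (derN du)) => //; rewrite opprK.
- by rewrite clampN.
- apply: (der_eq da) => //; rewrite !clampN// /acc_u lc_slopeNu /sqnorm sqrrN.
  by ring.
- apply: (der_eq (derN db)) => //; rewrite opprK clampN// /acc_w lc_slopeNu.
  by rewrite /sqnorm sqrrN.
Qed.

Definition hill_orbit u w a b := lc_solution mu k u w a b /\
  forall s, sqnorm (u s) (w s) < t /\ energy mu k u w a b s = 0.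

(** An orthogonal start on the u-axis is fixed by the symmetry [clamped_reverse], so by uniqueness
    the orbit is its own reflection. This carries the forward bounds to negative times, and the
    truncation is inactive on the whole line. *)
Lemma clamped_hill_orbit u w a b : clamped u w a b -> w 0 = 0 -> a 0 = 0 ->
  u 0 ^+ 2 < t -> energy mu k u w a b 0 = 0 ->
  hill_orbit u w a b /\
  forall s, [/\ u (- s) = u s, w (- s) = - w s, a (- s) = - a s & b (- s) = b s].
Proof.
move=> sol w0 a0 u0 E0.
have r0 : sqnorm (u 0) (w 0) < t by rewrite /sqnorm w0 expr0n addr0.
have inv := clamped_invariant mu01 t01 kt sol r0 E0.
have sym s : [/\ u (- s) = u s, w (- s) = - w s, a (- s) = - a s & b (- s) = b s].
  have := clamped_unique t01 V0 (s0 := 0) (clamped_reverse sol) sol.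
  case/(_ _ s) => [|-> wE aE ->]; first by rewrite oppr0 w0 a0 oppr0.
  by rewrite -wE -aE !opprK.
have {}inv s : [/\ sqnorm (u s) (w s) < t, a s ^+ 2 + b s ^+ 2 < V ^+ 2
    & energy mu k u w a b s = 0].
  have [s0|/ltW s0] := leP 0 s; first exact: inv.
  have := inv (- s); rewrite oppr_ge0 => /(_ s0).
  have [uE wE aE bE] := sym s.
  rewrite /energy uE wE aE bE /sqnorm !sqrrN /lc_potential /moon_dist /sqnorm.
  by rewrite mulrN !sqrrN.
split; last exact: sym.
split => s; last by case: (inv s).
have [rs vs _] := inv s; have := sol s.
have Ea : clamp V (a s) = a s.
  by rewrite clamp_id// norm_le_of_sqr//; have := sqr_ge0 (b s); lra.
have Eb : clamp V (b s) = b s.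
  by rewrite clamp_id// norm_le_of_sqr//; have := sqr_ge0 (a s); lra.
have Eu : clamp (Num.sqrt t) (u s) = u s.
  rewrite clamp_id// norm_le_of_sqr ?sqrtr_ge0// sqr_sqrtr ?(ltW t0)//.
  by move: rs; rewrite /sqnorm; have := sqr_ge0 (w s); lra.
have Ew : clamp (Num.sqrt t) (w s) = w s.
  rewrite clamp_id// norm_le_of_sqr ?sqrtr_ge0// sqr_sqrtr ?(ltW t0)//.
  by move: rs; rewrite /sqnorm; have := sqr_ge0 (u s); lra.
by rewrite Ea Eb Eu Ew.
Qed.

Section Orbit.
Variables (u w a b : R -> R).
Hypothesis orb : hill_orbit u w a b.

Let du s : has_deriv u s (a s). Proof. by case: (orb.1 s). Qed.
Let dw s : has_deriv w s (b s). Proof. by case: (orb.1 s). Qed.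
Let da s : has_deriv a s (acc_u mu k (u s) (w s) (b s)). Proof. by case: (orb.1 s). Qed.
Let db s : has_deriv b s (acc_w mu k (u s) (w s) (a s)). Proof. by case: (orb.1 s). Qed.

Lemma acc_u_le0 s : 0 <= u s -> b s <= 0 -> acc_u mu k (u s) (w s) (b s) <= 0.
Proof.
move=> us bs; have [/ltW rs _] := orb.2 s.
have h1 := lc_slope_gt0 mu01 t01 crit kt rs (or_introl erefl).
have h2 : 0 <= u s * lc_slope mu k 1 (u s) (w s) by rewrite mulr_ge0// ltW.
have h3 : sqnorm (u s) (w s) * b s <= 0 by rewrite mulr_ge0_le0// sqnorm_ge0.
by rewrite /acc_u; lra.
Qed.

(** At [u = 0] the potential force vanishes and strictness must come from the Coriolis term, whence
    the alternative [w s < 0], [b s < 0]. *)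
Lemma acc_u_lt0 s : 0 <= u s -> b s <= 0 -> 0 < u s \/ w s < 0 /\ b s < 0 ->
  acc_u mu k (u s) (w s) (b s) < 0.
Proof.
move=> us bs uw; have [/ltW rs _] := orb.2 s.
have h1 := lc_slope_gt0 mu01 t01 crit kt rs (or_introl erefl).
have h2 : 0 <= u s * lc_slope mu k 1 (u s) (w s) by rewrite mulr_ge0// ltW.
have h3 : sqnorm (u s) (w s) * b s <= 0 by rewrite mulr_ge0_le0// sqnorm_ge0.
case: uw => [u0|[w0 b0]].
  have h4 : 0 < u s * lc_slope mu k 1 (u s) (w s) by rewrite mulr_gt0.
  by rewrite /acc_u; lra.
have h4 : sqnorm (u s) (w s) * b s < 0.
  rewrite pmulr_rlt0// /sqnorm ltr_wpDl ?sqr_ge0//.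
  by rewrite exprn_even_gt0//= lt_eqF.
by rewrite /acc_u; lra.
Qed.

Lemma acc_w_gt0 s : w s <= 0 -> a s < 0 -> 0 < u s \/ w s < 0 ->
  0 < acc_w mu k (u s) (w s) (a s).
Proof.
move=> ws as0 uw; have [/ltW rs _] := orb.2 s.
have h1 := lc_slope_gt0 mu01 t01 crit kt rs (or_intror erefl).
have h2 : w s * lc_slope mu k (-1) (u s) (w s) <= 0 by rewrite mulr_le0_ge0// ltW.
have h4 : sqnorm (u s) (w s) * a s < 0.
  rewrite pmulr_rlt0// /sqnorm; case: uw => h.
    by rewrite ltr_pwDl ?sqr_ge0// exprn_gt0.
  by rewrite ltr_wpDl ?sqr_ge0// exprn_even_gt0//= lt_eqF.
by rewrite /acc_w; lra.
Qed.

(* The three ways an orbit can leave the region u > 0, w' < 0. *)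
Definition escapes_left := exists T, [/\ 0 < T, u T < 0 & forall r, 0 <= r <= T -> b r < 0].
Definition turns_back := exists T, [/\ 0 < T, 0 < b T & forall r, 0 <= r <= T -> 0 < u r].
Definition hits_axis := exists T, [/\ 0 < T, u T = 0, b T = 0,
   forall r, 0 <= r < T -> 0 < u r /\ b r < 0 & forall r, 0 < r <= T -> a r < 0 /\ w r < 0].

Hypotheses (w0 : w 0 = 0) (a0 : a 0 = 0).

(** [escapes_left] constrains only [b] up to its final time, so it admits the start [u 0 = 0]. If
    [u] stayed nonnegative for a short time, the Coriolis force with [w < 0], [b < 0] would make [a]
    negative and push [u] below 0. *)
Lemma collision_escapes : u 0 = 0 -> b 0 < 0 -> escapes_left.
Proof.
move=> u0 b0; apply: contrapT => /forallNP H.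
have [d [d0 hd]] := neg_near (der_cont (db 0)) b0.
pose T := d / 2; have T0 : 0 < T by rewrite /T; lra.
have bneg r : 0 <= r <= T -> b r < 0.
  by move=> /andP[r0 rT]; apply: hd; rewrite subr0 ger0_norm//; rewrite /T in rT; lra.
have wneg r : 0 < r <= T -> w r < 0.
  move=> /andP[r0 rT]; rewrite -oppr_gt0 -oppr0 -{1}w0.
  apply: (increasing_derive r0 (fun x _ => derN (dw x))) => x /andP[x0 xr].
  by rewrite oppr_gt0 bneg//; lra.
have upos r : 0 <= r <= T -> 0 <= u r.
  move=> /andP[]; rewrite le_eqVlt => /predU1P[<-|r0] rT; first by rewrite u0.
  rewrite leNgt; apply/negP => ur; apply: (H r); split => // x /andP[x0 xr].
  by apply: bneg; lra.
have aneg r : 0 < r <= T -> a r < 0.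
  move=> /andP[r0 rT]; rewrite -oppr_gt0 -oppr0 -{1}a0.
  apply: (increasing_derive r0 (fun x _ => derN (da x))) => x /andP[x0 xr].
  have xT : 0 <= x <= T by lra.
  rewrite oppr_gt0 acc_u_lt0 ?upos//; first by rewrite ltW// bneg.
  by right; split; [apply: wneg; lra|exact: bneg].
have : - u 0 < - u T.
  apply: (increasing_derive T0 (fun x _ => derN (du x))) => x /andP[x0 xr].
  by rewrite oppr_gt0 aneg//; lra.
by have := upos T; rewrite lexx ltW// => /(_ isT); lra.
Qed.

(** [turns_back] constrains only [u] up to its final time, so it admits a start at rest. If [b]
    stayed nonpositive, the force at [u > 0] would give [a < 0], whose Coriolis effect makes [b]
    increase above 0. *)
Lemma rest_turns_back : 0 < u 0 -> b 0 = 0 -> turns_back.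
Proof.
move=> u0 b0; apply: contrapT => /forallNP H.
have [d [d0 hd]] := pos_near (der_cont (du 0)) u0.
pose T := d / 2; have T0 : 0 < T by rewrite /T; lra.
have upos r : 0 <= r <= T -> 0 < u r.
  by move=> /andP[r0 rT]; apply: hd; rewrite subr0 ger0_norm//; rewrite /T in rT; lra.
have bneg r : 0 <= r <= T -> b r <= 0.
  move=> /andP[]; rewrite le_eqVlt => /predU1P[<-|r0] rT; first by rewrite b0.
  rewrite leNgt; apply/negP => br; apply: (H r); split => // x /andP[x0 xr].
  by apply: upos; lra.
have wneg r : 0 <= r <= T -> w r <= 0.
  move=> /andP[r0 rT]; rewrite -oppr_ge0 -oppr0 -{1}w0.
  apply: (nondecreasing_derive r0 (fun x _ => derN (dw x))) => x /andP[x0 xr].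
  by rewrite oppr_ge0 bneg//; lra.
have aneg r : 0 < r <= T -> a r < 0.
  move=> /andP[r0 rT]; rewrite -oppr_gt0 -oppr0 -{1}a0.
  apply: (increasing_derive r0 (fun x _ => derN (da x))) => x /andP[x0 xr].
  have xT : 0 <= x <= T by lra.
  by rewrite oppr_gt0 acc_u_lt0 ?bneg ?(ltW (upos x _))//; left; exact: upos.
have : b 0 < b T.
  apply: (increasing_derive T0 (fun x _ => db x)) => x /andP[x0 xr].
  have xT : 0 <= x <= T by lra.
  by apply: acc_w_gt0; [exact: wneg|apply: aneg; lra|left; exact: upos].
by have := bneg T; rewrite lexx ltW// => /(_ isT); lra.
Qed.

Lemma orbit_trichotomy : 0 < u 0 -> b 0 < 0 -> [\/ escapes_left, turns_back | hits_axis].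
Proof.
move=> u0 b0.
have cu := der_contT du; have cw := der_contT dw; have ca := der_contT da.
have cb := der_contT db.
have apart T : 0 < T -> (forall r, 0 <= r < T -> 0 < u r /\ b r < 0) ->
    forall r, 0 < r <= T -> a r < 0 /\ w r < 0.
  move=> T0 good r /andP[r0 rT]; split.
    rewrite -oppr_gt0 -oppr0 -{1}a0.
    apply: (increasing_derive r0 (fun x _ => derN (da x))) => x /andP[x0 xr].
    have [ux bx] : 0 < u x /\ b x < 0 by apply: good; lra.
    by rewrite oppr_gt0 acc_u_lt0 ?ltW//; left.
  rewrite -oppr_gt0 -oppr0 -{1}w0.
  apply: (increasing_derive r0 (fun x _ => derN (dw x))) => x /andP[x0 xr].
  by rewrite oppr_gt0; apply: (good x _).2; lra.
have cNu : continuous (fun s => - u s) by move=> s; exact: cvgN (cu s).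
pose h s : R := Num.max (- u s) (b s).
have ch : continuous h.
  by move=> s; apply: (continuous_max (f := fun s => - u s) (g := b)); [exact: cNu|exact: cb].
have h0 : h 0 < 0 by rewrite gt_max oppr_lt0 u0.
have hlt r : h r < 0 -> 0 < u r /\ b r < 0 by rewrite gt_max oppr_lt0 => /andP[].
have [s [s0 hs]] : exists s, 0 <= s /\ 0 <= h s.
  apply: contrapT => /forallNP H.
  have good r : 0 <= r -> 0 < u r /\ b r < 0.
    by move=> r0; apply: hlt; rewrite ltNge; apply/negP => hr; apply: (H r).
  have a1 : a 1 < 0 by apply: (apart 1 _ _ 1 _).1 => //; [move=> r /andP[r0 _]; exact: good|lra].
  (* The zero of the tangent line to [u] at time 1; [u] is concave as long as the orbit stays in the
     region, hence lies below this line. *)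
  pose T := 1 - u 1 / a 1.
  have [u1 _] := good 1 ler01.
  have T1 : 1 < T by rewrite /T ltrDl oppr_gt0 pmulr_rlt0// invr_lt0.
  have : - u 1 + a 1 * 1 <= - u T + a 1 * T.
    apply: (nondecreasing_derive (f := fun s => - u s + a 1 * s) (ltW T1)
      (fun x _ => derD (derN (du x)) (derM (derC (a 1) x) (derI x)))) => x /andP[x1 xT].
    have : - a 1 <= - a x.
      apply: (nondecreasing_derive (ltW x1) (fun y _ => derN (da y))) => y /andP[y1 yx].
      have [uy b_y] := good y (le_trans ler01 (ltW y1)).
      by rewrite oppr_ge0 acc_u_le0// ltW.
    lra.
  have -> : a 1 * T = a 1 - u 1 by rewrite /T; field; rewrite lt_eqF.
  have [uT _] := good T (le_trans ler01 (ltW T1)).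
  lra.
have [T [/andP[T0 Ts] hT hTlt]] := first_zero ch s0 h0 hs.
have good r : 0 <= r < T -> 0 < u r /\ b r < 0 by move=> /hTlt /hlt.
have [aT wT] : a T < 0 /\ w T < 0 by apply: apart good _ _; rewrite // T0 lexx.
have uT : 0 <= u T.
  by rewrite -oppr_le0; apply: (nonpos_limit cNu T0) => [r /good[]|];
     rewrite ?oppr_lt0// ltW//= lexx.
have bT : b T <= 0.
  by apply: (nonpos_limit cb T0) => [r /good[]|]; rewrite // ltW//= lexx.
(* At the first exit time [a T < 0] and [w T < 0], so an orbit on the axis [u = 0] crosses it, and
   an orbit with [b T = 0] has [w'' > 0] nearby. *)
move: uT bT; rewrite le_eqVlt => /predU1P[uT|uT]; rewrite le_eqVlt => /predU1P[bT|bT].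
- by apply: Or33; exists T; split => //; exact: apart.
- apply: Or31.
  have [d1 [d10 hd1]] := neg_near (ca T) aT; have [d2 [d20 hd2]] := neg_near (cb T) bT.
  pose d := Num.min d1 d2; pose e := d / 2.
  have dd1 : d <= d1 by rewrite ge_min lexx.
  have dd2 : d <= d2 by rewrite ge_min lexx orbT.
  have d0 : 0 < d by rewrite lt_min d10.
  exists (T + e); split; first by rewrite /e; lra.
    rewrite -oppr_gt0 -oppr0 {1}uT.
    have Te : T < T + e by rewrite /e; lra.
    apply: (increasing_derive Te (fun x _ => derN (du x))) => x /andP[x1 x2].
    by rewrite oppr_gt0 hd1// gtr0_norm; rewrite /e in x2; lra.
  move=> r /andP[r0 rT]; have [rlt|rge] := ltP r T; first by apply: (good r _).2; rewrite r0.
  by apply: hd2; rewrite ger0_norm; rewrite /e in rT; lra.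
- apply: Or32.
  have [d1 [d10 hd1]] := neg_near (ca T) aT; have [d2 [d20 hd2]] := neg_near (cw T) wT.
  have [d3 [d30 hd3]] := pos_near (cu T) uT.
  pose d := Num.min d1 (Num.min d2 d3); pose e := d / 2.
  have dd1 : d <= d1 by rewrite ge_min lexx.
  have dd2 : d <= d2 by rewrite !ge_min lexx orbT.
  have dd3 : d <= d3 by rewrite !ge_min lexx !orbT.
  have d0 : 0 < d by rewrite !lt_min d10 d20.
  exists (T + e); split; first by rewrite /e; lra.
    rewrite -bT; have Te : T < T + e by rewrite /e; lra.
    apply: (increasing_derive Te (fun x _ => db x)) => x /andP[x1 x2].
    have xT : `|x - T| < d by rewrite gtr0_norm; rewrite /e in x2; lra.
    have wx : w x < 0 by apply: hd2; lra.
    by apply: acc_w_gt0; [exact: ltW|apply: hd1; lra|right].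
  move=> r /andP[r0 rT]; have [rlt|rge] := ltP r T; first by apply: (good r _).1; rewrite r0.
  by apply: hd3; rewrite ger0_norm; rewrite /e in rT; lra.
- have : h T < 0 by rewrite gt_max oppr_lt0 uT.
  by rewrite hT ltxx.
Qed.

End Orbit.
End Shooting.

(** * Existence of the retrograde orbit by varying the starting point *)

Section RetrogradeOrbit.
Context {R : realType}.
Variables (mu k t : R).
Hypotheses (mu01 : 0 < mu < 1) (t01 : 0 < t < 1) (crit : critical_radius mu t).
Hypothesis kt : (1 - mu) * tidal t + mu * tidal (1 - t) < k.
Implicit Types (x y s : R) (u w a b : R -> R).

Notation V := (speed_bound t).
Notation clamped := (clamped_solution mu k t V).

Let t0 : 0 < t. Proof. by case/andP: t01. Qed.
Let t1 : t < 1. Proof. by case/andP: t01. Qed.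
Let V0 : 0 <= V. Proof. by have := speed_bound_ge3 t01; lra. Qed.

Let pot s := lc_potential mu k s 0.

Let pot_cont : continuous pot.
Proof.
move=> s; have h : (fun=> 0 : R) s ^+ 2 < 1 by rewrite expr0n.
exact: (der_cont (der_lc_potential mu k h (derI s) (derC 0 s))).
Qed.

(** On the u-axis W is [- (1 - mu)] at the collision and positive where the axis meets the circle
    [sqnorm = t]; the first zero lies strictly between. *)
Lemma zero_velocity_point : exists c : R, [/\ 0 < c, c ^+ 2 < t, pot c = 0
  & forall s, 0 <= s < c -> pot s < 0].
Proof.
have p0 : pot 0 < 0.
  have [mu0 mu1] := andP mu01.
  rewrite /pot /lc_potential /sqnorm !expr0n/= addr0 mul0r expr0n/= mul0r addr0 mulr1 sub0r.
  by rewrite oppr_lt0 subr_gt0.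
have pt : 0 < pot (Num.sqrt t).
  apply: (lc_potential_gt0 mu01 t01 kt).
  by rewrite /sqnorm expr0n addr0 sqr_sqrtr// ltW.
have [c [/andP[c0 ct] pc plt]] := first_zero pot_cont (sqrtr_ge0 t) p0 (ltW pt).
exists c; split => //.
have : c < Num.sqrt t by rewrite lt_neqAle ct andbT; apply/eqP => cE; move: pt; rewrite -cE pc ltxx.
by rewrite -[in X in _ -> X](sqr_sqrtr (ltW t0)) => h; rewrite ltr_sqr ?nnegrE ?sqrtr_ge0// ltW.
Qed.

(* Half of a retrograde orbit: it leaves the positive u-axis orthogonally at time 0 and
   reaches the w-axis orthogonally at time T; the last two clauses continue it by reflection. *)
Definition retrograde u w a b (T : R) :=
  [/\ hill_orbit mu k t u w a b, 0 < T,
      forall r, 0 <= r < T -> 0 < u r /\ b r < 0,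
      forall r, 0 < r <= T -> a r < 0 /\ w r < 0
    & [/\ w 0 = 0, u T = 0,
        forall s, [/\ u (- s) = u s, w (- s) = - w s, a (- s) = - a s & b (- s) = b s]
      & forall s, [/\ u (2 * T - s) = - u s, w (2 * T - s) = w s,
          a (2 * T - s) = a s & b (2 * T - s) = - b s]]].

Lemma retrograde_exists : exists u w a b (T : R), retrograde u w a b T.
Proof.
have [c [c0 ct pc plt]] := zero_velocity_point.
(* The downward velocity prescribed by [2 b^2 + W = 0]. Where W is positive the square root is 0 by
   convention, so [beta] is continuous on the whole line and openness can be stated in [R] rather
   than in [0, c]. *)
pose beta s : R := - Num.sqrt (- pot s * 2^-1).
have cbeta : continuous beta.
  move=> s; suff : cont_at beta s by [].
  apply: catN; apply: cat_sqrt; apply: catM; last exact: catC.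
  by apply: catN; exact: pot_cont.
have [U [W [A [B HB]]]] : exists U W A B : R -> R -> R, forall s,
    clamped (U s) (W s) (A s) (B s) /\
    [/\ U s 0 = s, W s 0 = 0, A s 0 = 0 & B s 0 = beta s].
  have /choice[U /choice[W /choice[A /choice[B HB]]]] :=
    fun s => clamped_exists mu k t01 V0 s 0 0 (beta s).
  by exists U, W, A, B.
have pot_le0 s : 0 <= s <= c -> pot s <= 0.
  move=> /andP[s0]; rewrite le_eqVlt => /predU1P[->|sc]; first by rewrite pc.
  by rewrite ltW// plt// s0.
have orb s : 0 <= s <= c -> hill_orbit mu k t (U s) (W s) (A s) (B s) /\
    forall r, [/\ U s (- r) = U s r, W s (- r) = - W s r, A s (- r) = - A s r
      & B s (- r) = B s r].
  move=> sc; have [sol [us ws As bs]] := HB s.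
  apply: (clamped_hill_orbit mu01 t01 kt) => //.
    rewrite us; apply: le_lt_trans ct; rewrite ler_sqr ?nnegrE ?(ltW c0)//; lra.
  rewrite /energy us ws As bs expr0n/= add0r /beta sqrrN sqr_sqrtr.
    by rewrite -/(pot s); lra.
  by have := pot_le0 s sc; lra.
have [K dep] := clamped_dependence mu k t01 V0.
have near_sol s0 (T e : R) : 0 <= T -> 0 < e -> exists d : R, 0 < d /\ forall s, `|s - s0| < d ->
    forall r, 0 <= r <= T -> `|U s r - U s0 r| < e /\ `|B s r - B s0 r| < e.
  move=> T0 e0; pose E := expR (`|K| * T).
  pose f s : R := ((s - s0) ^+ 2 + (beta s - beta s0) ^+ 2) * E - e ^+ 2.
  have cf : {for s0, continuous f}.
    have cid : cont_at (fun s : R => s) s0 by exact: cvg_id.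
    suff : cont_at f s0 by [].
    apply: catD; last exact: catC.
    apply: catM; last exact: catC.
    apply: catD; apply: catX; apply: catD; [exact: cid|exact: catC|exact: cbeta|exact: catC].
  have [|d [d0 hd]] := neg_near cf.
    by rewrite /f !subrr expr0n/= addr0 mul0r sub0r oppr_lt0 exprn_gt0.
  exists d; split => // s /hd; rewrite /f subr_lt0 => fs r /andP[r0 rT].
  have [sol [us ws As bs]] := HB s; have [sol0 [us0 ws0 As0 bs0]] := HB s0.
  have := dep _ _ _ _ _ _ _ _ r sol sol0 r0.
  rewrite us ws As bs us0 ws0 As0 bs0 !subrr expr0n/= !addr0 => h.
  have h2 : ((s - s0) ^+ 2 + (beta s - beta s0) ^+ 2) * expR (K * r) <=
      ((s - s0) ^+ 2 + (beta s - beta s0) ^+ 2) * E.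
    rewrite ler_wpM2l ?addr_ge0 ?sqr_ge0// ler_expR.
    apply: (@le_trans _ _ (`|K| * r)); first by rewrite ler_wpM2r// ler_norm.
    by rewrite ler_wpM2l.
  have := sqr_ge0 (U s r - U s0 r); have := sqr_ge0 (W s r - W s0 r).
  have := sqr_ge0 (A s r - A s0 r); have := sqr_ge0 (B s r - B s0 r).
  by move=> *; split; apply: lt_norm_of_sqr => //; lra.
have cU s : continuous (U s) by move=> r; case: (HB s) => /(_ r)[/der_cont].
have cB s : continuous (B s) by move=> r; case: (HB s) => /(_ r)[_ _ _ /der_cont].
pose P s := escapes_left (U s) (B s); pose Q s := turns_back (U s) (B s).
have oP s : P s -> exists d : R, 0 < d /\ forall r, `|r - s| < d -> P r.
  move=> [T [T0 uT bT]].
  have [r0] := EVT_max (ltW T0) (continuous_subspaceT (cB s)).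
  rewrite in_itv/= => r0T Br0; have br0 := bT _ r0T.
  (* The margin by which the condition holds, positive because [B s] attains its maximum on [0, T];
     solutions that are [e]-close on [0, T] inherit the condition. *)
  pose e := Num.min (- U s T) (- B s r0).
  have e0 : 0 < e by rewrite lt_min !oppr_gt0 uT.
  have eU : e <= - U s T by rewrite ge_min lexx.
  have eB : e <= - B s r0 by rewrite ge_min lexx orbT.
  have [d [d0 hd]] := near_sol s T e (ltW T0) e0.
  exists d; split => // s' /hd{}hd; exists T; split => //.
    by have [|+ _] := hd T; rewrite ?lexx ?(ltW T0)// ltr_norml; lra.
  move=> r rT; have [_] := hd r rT; have := Br0 r; rewrite in_itv/= => /(_ rT).
  by rewrite ltr_norml; lra.
have oQ s : Q s -> exists d : R, 0 < d /\ forall r, `|r - s| < d -> Q r.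
  move=> [T [T0 bT uT]].
  have [r0] := EVT_min (ltW T0) (continuous_subspaceT (cU s)).
  rewrite in_itv/= => r0T Ur0; have ur0 := uT _ r0T.
  pose e := Num.min (B s T) (U s r0).
  have e0 : 0 < e by rewrite lt_min bT.
  have eB : e <= B s T by rewrite ge_min lexx.
  have eU : e <= U s r0 by rewrite ge_min lexx orbT.
  have [d [d0 hd]] := near_sol s T e (ltW T0) e0.
  exists d; split => // s' /hd{}hd; exists T; split => //.
    by have [|_ +] := hd T; rewrite ?lexx ?(ltW T0)// ltr_norml; lra.
  move=> r rT; have [+ _] := hd r rT; have := Ur0 r; rewrite in_itv/= => /(_ rT).
  by rewrite ltr_norml; lra.
have disj s : P s -> Q s -> False.
  move=> [T [T0 uT bT]] [T' [T'0 bT' uT']]; have [TT|/ltW TT] := leP T T'.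
    by have := uT' T; rewrite (ltW T0) TT => /(_ isT); lra.
  by have := bT T'; rewrite (ltW T'0) TT => /(_ isT); lra.
have bneg s : 0 <= s < c -> B s 0 < 0.
  move=> sc; have [_ [_ _ _ ->]] := HB s; rewrite oppr_lt0 sqrtr_gt0.
  by have := plt s sc; lra.
have [s [sc [T [T0 uT bT good apart]]]] : exists s, 0 <= s <= c /\
    hits_axis (U s) (W s) (A s) (B s).
  apply: contrapT => /forallNP none.
  apply: (two_opens (ltW c0) _ _ _ disj oP oQ).
  - have c00 : 0 <= (0 : R) <= c by rewrite lexx ltW.
    have [_ [us ws As _]] := HB 0.
    apply: (collision_escapes mu01 t01 crit kt (orb 0 c00).1 ws As us).
    by apply: bneg; rewrite lexx.
  - have cc : 0 <= c <= c by rewrite lexx ltW.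
    have [_ [us ws As bs]] := HB c.
    apply: (rest_turns_back mu01 t01 crit kt (orb c cc).1 ws As); first by rewrite us.
    by rewrite bs /beta pc oppr0 mul0r sqrtr0 oppr0.
  - move=> s sc; have [_ [us ws As bs]] := HB s.
    have [s0|s0] := eqVneq s 0.
      left; rewrite s0; have [_ [us' ws' As' _]] := HB 0.
      have c00 : 0 <= (0 : R) <= c by rewrite lexx ltW.
      apply: (collision_escapes mu01 t01 crit kt (orb 0 c00).1 ws' As' us').
      by apply: bneg; rewrite lexx.
    have [s1|s1] := eqVneq s c.
      right; rewrite s1; have [_ [us' ws' As' bs']] := HB c.
      have cc : 0 <= c <= c by rewrite lexx ltW.
      apply: (rest_turns_back mu01 t01 crit kt (orb c cc).1 ws' As'); first by rewrite us'.
      by rewrite bs' /beta pc oppr0 mul0r sqrtr0 oppr0.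
    have [sc0 sc1] := andP sc.
    have s00 : 0 < s by rewrite lt_def s0.
    have s11 : s < c by rewrite lt_neqAle s1.
    have := orbit_trichotomy mu01 t01 crit kt (orb s sc).1 ws As.
    rewrite us => /(_ s00); case; [by apply: bneg; rewrite sc0|by left|by right|].
    by move=> hit; case: (none s).
have [sol [us ws As bs]] := HB s; have [orbs sym] := orb s sc.
exists (U s), (W s), (A s), (B s), T; split => //; split => // r.
(* At time [T] the orbit meets the w-axis orthogonally, [u = b = 0], so it agrees there with its
   mirror image and coincides with it. *)
have := clamped_unique t01 V0 (s0 := T) (clamped_mirror t01 (2 * T) sol) sol.
have -> : 2 * T - T = T by ring.
case/(_ _ r) => [|uE -> -> bE]; first by rewrite uT bT oppr0.
by rewrite -uE -bE !opprK.
Qed.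

End RetrogradeOrbit.

(** * The Hill's region *)

Section Plane.
Context {R : realType}.
Implicit Types (mu c t x y : R) (q v : 'rV[R]_2).

Lemma ord1_lift : (1 : 'I_2) = lift ord0 ord0. Proof. exact: val_inj. Qed.

Lemma dot2 (v w : 'rV[R]_2) : dot v w = v 0 0 * w 0 0 + v 0 1 * w 0 1.
Proof. by rewrite /dot !big_ord_recl big_ord0 addr0 ord1_lift. Qed.

Lemma enorm2 v : enorm v = Num.sqrt (v 0 0 ^+ 2 + v 0 1 ^+ 2).
Proof. by rewrite /enorm dot2 -!expr2. Qed.

Lemma vec2_0 x y : vec2 x y 0 0 = x. Proof. by rewrite mxE. Qed.
Lemma vec2_1 x y : vec2 x y 0 1 = y. Proof. by rewrite mxE. Qed.

Lemma row2P (v w : 'rV[R]_2) : v 0 0 = w 0 0 -> v 0 1 = w 0 1 -> v = w.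
Proof.
move=> h0 h1; apply/rowP => -[[|[|//]] i].
- by rewrite (_ : Ordinal i = 0)//; exact: val_inj.
- by rewrite (_ : Ordinal i = 1)//; exact: val_inj.
Qed.

Lemma enorm_earth mu q :
  enorm (q - position mu Earth) = Num.sqrt ((q 0 0 - mu) ^+ 2 + q 0 1 ^+ 2).
Proof. by rewrite enorm2 !mxE /= subr0. Qed.

Lemma enorm_moon mu q :
  enorm (q - position mu Moon) = Num.sqrt ((1 + (q 0 0 - mu)) ^+ 2 + q 0 1 ^+ 2).
Proof. by rewrite enorm2 !mxE /= subr0; congr (Num.sqrt (_ ^+ 2 + _)); ring. Qed.

(** The origin is the centre of mass, so [(1 - mu) |q - E|^2 + mu |q - M|^2 = |q|^2 + mu (1 - mu)];
    the centrifugal term splits between the two primaries. *)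
Lemma potentialE mu q : potential mu q = mu * (1 - mu) / 2
  - (1 - mu) * tidal (enorm (q - position mu Earth))
  - mu * tidal (enorm (q - position mu Moon)).
Proof.
have nn x y : 0 <= x ^+ 2 + y ^+ 2 by rewrite addr_ge0 ?sqr_ge0.
rewrite /potential /tidal !(enorm_earth mu) !enorm_moon enorm2 !sqr_sqrtr ?nn//.
by move: (Num.sqrt _)^-1 => a; move: (Num.sqrt _)^-1 => b; field.
Qed.

Lemma hamiltonianE mu q p : hamiltonian mu (q, p) =
  2^-1 * ((p 0 0 + q 0 1) ^+ 2 + (p 0 1 - q 0 0) ^+ 2) + potential mu q.
Proof.
have nn x y : 0 <= x ^+ 2 + y ^+ 2 by rewrite addr_ge0 ?sqr_ge0.
rewrite /hamiltonian /potential /=.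
move: (enorm (q - position mu Earth))^-1 (enorm (q - position mu Moon))^-1 => a b.
by rewrite !enorm2 !sqr_sqrtr ?nn//; field.
Qed.

Lemma ell1_critical mu l : 0 < mu < 1 -> is_ell1 mu l -> exists t,
  [/\ 0 < t < 1, critical_radius mu t
    & hamiltonian mu (L1 l) = mu * (1 - mu) / 2 - (1 - mu) * tidal t - mu * tidal (1 - t)].
Proof.
move=> mu01 [[t [t01 lE]] [dU U0]]; exists t; have [t0 t1] := andP t01.
have l0 : l 0 0 = mu - t by rewrite lE !mxE /=; ring.
have l1 : l 0 1 = 0 by rewrite lE !mxE /= !mulr0 addr0.
pose e1 : 'rV[R]_2 := vec2 1 0.
(* The restriction of the potential to the axis of the primaries; its derivative at 0 is the
   directional derivative that the critical point annihilates. *)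
pose phi s := potential mu (s *: e1 + l).
have phiE s : phi s = mu * (1 - mu) / 2
  - (1 - mu) * tidal (Num.sqrt ((s - t) ^+ 2)) - mu * tidal (Num.sqrt ((1 - t + s) ^+ 2)).
  rewrite /phi potentialE (enorm_earth mu) enorm_moon !mxE /= l0 l1 mulr0 addr0 expr0n/= !addr0 mulr1.
  by congr (_ - _ * tidal (Num.sqrt (_ ^+ 2)) - _ * tidal (Num.sqrt (_ ^+ 2))); ring.
have dphi0 : has_deriv phi 0 0.
  have dfe := diff_derivable (v := e1) dU.
  have E : 'D_e1 (potential mu) l = 0 by rewrite deriveE.
  split; first by move/derivable1P : dfe.
  apply: etrans E; rewrite /derive; set d := (fun _ : R => _); set d' := (fun _ : R => _).
  suff -> : d = d' by [].
  by apply/funext => h; rewrite /d /d' /phi /= scale0r add0r addr0 [_%:A]mulr1.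
split => //; last first.
  rewrite /L1 hamiltonianE !vec2_0 !vec2_1 addNr subrr expr0n/= addr0 mulr0 add0r.
  have := phiE 0; rewrite /phi scale0r add0r sub0r addr0 !sqrtr_sqr normrN !gtr0_norm//.
  by rewrite subr_gt0.
have ts0 : 0 < (0 - t) ^+ 2 by rewrite sub0r sqrrN exprn_gt0.
have mt0 : 0 < (1 - t + 0) ^+ 2 by rewrite addr0 exprn_gt0// subr_gt0.
have sE : Num.sqrt ((0 - t) ^+ 2) = t by rewrite sqrtr_sqr sub0r normrN gtr0_norm.
have sM : Num.sqrt ((1 - t + 0) ^+ 2) = 1 - t by rewrite sqrtr_sqr addr0 gtr0_norm ?subr_gt0.
have d1 := derSqrt (f := fun s => (s - t) ^+ 2) ts0 (derX 1 (derD (derI 0) (derC (- t) 0))).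
have d2 := derSqrt (f := fun s => (1 - t + s) ^+ 2) mt0 (derX 1 (derD (derC (1 - t) 0) (derI 0))).
have d3 : has_deriv phi 0 ((1 - mu) * (t - t ^- 2) - mu * ((1 - t) - (1 - t) ^- 2)).
  have n1 : Num.sqrt ((0 - t) ^+ 2) != 0 by rewrite sE gt_eqF.
  have n2 : Num.sqrt ((1 - t + 0) ^+ 2) != 0 by rewrite sM gt_eqF ?subr_gt0.
  have h1 := der_tidal (f := fun s => Num.sqrt ((s - t) ^+ 2)) n1 d1.
  have h2 := der_tidal (f := fun s => Num.sqrt ((1 - t + s) ^+ 2)) n2 d2.
  have h3 := derD (derD (derC (mu * (1 - mu) / 2) 0)
    (derN (derM (derC (1 - mu) 0) h1))) (derN (derM (derC mu 0) h2)).
  apply: (der_eq h3) => [s|]; first by rewrite phiE.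
  by rewrite /= sE sM; field; rewrite !gt_eqF// subr_gt0.
have := der_unique d3 dphi0; rewrite /critical_radius; lra.
Qed.

End Plane.

(** * The component of the Hill's region around the earth *)

Section HillRegion.
Context {R : realType}.
Implicit Types (mu c u w : R) (q : 'rV[R]_2).

Definition lc_point mu u w : 'rV[R]_2 := vec2 (mu + (u ^+ 2 - w ^+ 2)) (2 * u * w).

Lemma lc_point_earth mu u w : enorm (lc_point mu u w - position mu Earth) = sqnorm u w.
Proof.
rewrite (enorm_earth mu) vec2_0 vec2_1 -[RHS]ger0_norm ?sqnorm_ge0// -sqrtr_sqr.
by congr Num.sqrt; rewrite /sqnorm; ring.
Qed.

Lemma lc_point_moon mu u w : enorm (lc_point mu u w - position mu Moon) = moon_dist u w.
Proof.
rewrite enorm_moon vec2_0 vec2_1 /moon_dist.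
by congr (Num.sqrt (_ ^+ 2 + _)); ring.
Qed.

Lemma potential_lc mu c u w : sqnorm u w != 0 ->
  potential mu (lc_point mu u w) - c =
  lc_potential mu (mu * (1 - mu) / 2 - c) u w / sqnorm u w.
Proof.
move=> r0; rewrite potentialE lc_point_earth lc_point_moon /lc_potential [tidal (sqnorm u w)]/tidal.
by field.
Qed.

Lemma hill_regionP mu c q : hill_region mu c q <->
  [/\ q <> position mu Earth, q <> position mu Moon & potential mu q <= c].
Proof.
split=> [[[q' p] [/= qE qM Hc] <-]|[qE qM Uc]].
  split => //; rewrite -Hc hamiltonianE lerDr mulr_ge0 ?invr_ge0//.
  by rewrite addr_ge0 ?sqr_ge0.
(* All kinetic energy is put into [p1 + q2], while [p2 - q1] is 0. *)
exists (q, vec2 (Num.sqrt (2 * (c - potential mu q)) - q 0 1) (q 0 0)) => //.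
split => //=; rewrite hamiltonianE vec2_0 vec2_1 subrK subrr expr0n/= addr0 sqr_sqrtr.
  by field.
by rewrite mulr_ge0// subr_ge0.
Qed.

Lemma enorm_earth_continuous mu : continuous (fun q => enorm (q - position mu Earth)).
Proof.
have -> : (fun q => enorm (q - position mu Earth)) =
    (fun q => Num.sqrt ((q 0 0 - mu) ^+ 2 + q 0 1 ^+ 2)).
  by apply/funext => q; rewrite (enorm_earth mu).
move=> q.
suff : cont_at (fun q : 'rV[R]_2 => Num.sqrt ((q 0 0 - mu) ^+ 2 + q 0 1 ^+ 2)) q by [].
apply: cat_sqrt; apply: catD; apply: catX; last exact: cat_coord.
by apply: catD; [exact: cat_coord|exact: catC].
Qed.

Variables (mu c t : R).
Hypotheses (mu01 : 0 < mu < 1) (t01 : 0 < t < 1) (crit : critical_radius mu t).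
Hypothesis kt : (1 - mu) * tidal t + mu * tidal (1 - t) < mu * (1 - mu) / 2 - c.

Lemma hill_barrier q : enorm (q - position mu Earth) = t -> c < potential mu q.
Proof.
have [t0 t1] := andP t01.
move=> qt; rewrite potentialE qt.
have : 1 - t <= enorm (q - position mu Moon) <= 1 + t.
  have /(congr1 (fun x => x ^+ 2)) := qt; rewrite (enorm_earth mu) sqr_sqrtr ?addr_ge0 ?sqr_ge0//.
  rewrite enorm_moon; move: (q 0 0 - mu) (q 0 1) => x y xy.
  have xt : `|x| <= t by rewrite norm_le_of_sqr ?(ltW t0)//; have := sqr_ge0 y; lra.
  have h1 : 0 <= 1 - t by lra.
  have h2 : 0 <= 1 + t by lra.
  rewrite -(ger0_norm h1) -(ger0_norm h2) -!sqrtr_sqr.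
  by move: xt; rewrite ler_norml => xt; rewrite !ler_wsqrtr//; lra.
by move=> /(potential_barrier mu01 t01 kt); lra.
Qed.

(** The distance to the earth takes an interval of values on a component; if it reached [t], the
    component would contain a point of the circle on which U > c. *)
Lemma hill_component_disc q q' : enorm (q - position mu Earth) < t ->
  connected_component (hill_region mu c) q q' -> enorm (q' - position mu Earth) < t.
Proof.
move=> qt Cq'; rewrite ltNge; apply/negP => q't.
have Hq : hill_region mu c q.
  apply: contrapT => /connected_component_out E.
  by move: Cq'; rewrite E.
have /connected_intervalP itv : connected
    ((fun q => enorm (q - position mu Earth)) @` connected_component (hill_region mu c) q).
  apply: connected_continuous_connected; first exact: component_connected.
  by apply: continuous_subspaceT; exact: enorm_earth_continuous.
have [p Cp pt] := itv (enorm (q - position mu Earth)) (enorm (q' - position mu Earth))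
  (ex_intro2 _ _ q (connected_component_refl Hq) erefl) (ex_intro2 _ _ q' Cq' erefl) t
  (introT andP (conj (ltW qt) q't)).
have /hill_regionP[_ _] := connected_component_sub Cp.
by rewrite leNgt hill_barrier.
Qed.

Lemma hill_component_bounded q : enorm (q - position mu Earth) < t ->
  bounded_set (connected_component (hill_region mu c) q).
Proof.
have [mu0 mu1] := andP mu01; have [t0 t1] := andP t01.
move=> qt; exists 2; split => // M M2 p /(hill_component_disc qt).
rewrite (enorm_earth mu) => pt.
have {}pt : (p 0 0 - mu) ^+ 2 + p 0 1 ^+ 2 <= 1 ^+ 2.
  have nn : 0 <= (p 0 0 - mu) ^+ 2 + p 0 1 ^+ 2 by rewrite addr_ge0 ?sqr_ge0.
  rewrite -[leLHS](sqr_sqrtr nn) ler_sqr ?nnegrE ?sqrtr_ge0//.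
  by rewrite (le_trans (ltW pt)) ?(ltW t1).
have p0 : `|p 0 0 - mu| <= 1 by rewrite norm_le_of_sqr//; have := sqr_ge0 (p 0 1); lra.
have p1 : `|p 0 1| <= 1 by rewrite norm_le_of_sqr//; have := sqr_ge0 (p 0 0 - mu); lra.
rewrite /Num.Def.normr/= mx_normrE (bigmax_le _ _)//=; first by lra.
move=> -[i j] _ /=; rewrite ord1; case: j => -[|[|//]] j.
- rewrite (_ : Ordinal j = 0); last exact: val_inj.
  by move: p0; rewrite !ler_norml; lra.
- rewrite (_ : Ordinal j = 1); last exact: val_inj.
  by lra.
Qed.

(** Both slopes being positive, W increases along the ray [l -> l z], so the whole segment from the
    point towards the earth stays in the Hill's region. In the q-plane the scaling factor is
    [l * l]. *)
Lemma hill_component_closure u w : 0 < sqnorm u w <= t ->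
  lc_potential mu (mu * (1 - mu) / 2 - c) u w <= 0 ->
  closure (connected_component (hill_region mu c) (lc_point mu u w)) (position mu Earth).
Proof.
have [mu0 mu1] := andP mu01; have [t0 t1] := andP t01.
move=> /andP[r0 rt] W0.
pose d : 'rV[R]_2 := vec2 (u ^+ 2 - w ^+ 2) (2 * u * w).
pose g (l : R) := position mu Earth + (l * l) *: d.
have gE l : g l = lc_point mu (l * u) (l * w).
  by apply: row2P; rewrite !mxE /=; ring.
have cg : continuous g.
  move=> l; apply: cvgD; first exact: cvg_cst.
  by apply: cvgZ; [apply: cvgM; exact: cvg_id|exact: cvg_cst].
have rE l : sqnorm (l * u) (l * w) = l ^+ 2 * sqnorm u w by rewrite /sqnorm; ring.
have rl l : 0 <= l <= 1 -> sqnorm (l * u) (l * w) <= t.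
  move=> /andP[l0 l1]; rewrite rE; apply: le_trans rt; rewrite ler_piMl ?(ltW r0)//.
  by rewrite exprn_ile1.
have Wl l : 0 < l <= 1 -> lc_potential mu (mu * (1 - mu) / 2 - c) (l * u) (l * w) <= 0.
  move=> /andP[l0 l1]; apply: le_trans W0; rewrite -[in leRHS](mul1r u) -[in leRHS](mul1r w).
  have dd x : 0 <= x <= 1 -> has_deriv
      (fun x => lc_potential mu (mu * (1 - mu) / 2 - c) (x * u) (x * w)) x
      (2 * x * u ^+ 2 * lc_slope mu (mu * (1 - mu) / 2 - c) 1 (x * u) (x * w) +
       2 * x * w ^+ 2 * lc_slope mu (mu * (1 - mu) / 2 - c) (-1) (x * u) (x * w)).
    move=> x01; have w1 : (x * w) ^+ 2 < 1.
      by have := rl x x01; rewrite /sqnorm; have := sqr_ge0 (x * u); lra.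
    have := @der_lc_potential R mu (mu * (1 - mu) / 2 - c) (fun x => x * u) (fun x => x * w) x
      _ _ w1 (derM (derI x) (derC u x)) (derM (derI x) (derC w x)).
    by move=> h; apply: (der_eq h) => //; ring.
  apply: (nondecreasing_derive l1 (fun x (h : l <= x <= 1) => dd x _)) => [x /andP[x1 x2]|x /andP[x1 x2]]; first by lra.
  have x01 : 0 <= x <= 1 by lra.
  have x0 : 0 <= x by lra.
  have h1 := lc_slope_gt0 mu01 t01 crit kt (rl x x01) (or_introl erefl).
  have h2 := lc_slope_gt0 mu01 t01 crit kt (rl x x01) (or_intror erefl).
  have h3 : 0 <= 2 * x * u ^+ 2 * lc_slope mu (mu * (1 - mu) / 2 - c) 1 (x * u) (x * w).
    exact: mulr_ge0 (mulr_ge0 (mulr_ge0 (ler0n R 2) x0) (sqr_ge0 u)) (ltW h1).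
  have h4 : 0 <= 2 * x * w ^+ 2 * lc_slope mu (mu * (1 - mu) / 2 - c) (-1) (x * u) (x * w).
    exact: mulr_ge0 (mulr_ge0 (mulr_ge0 (ler0n R 2) x0) (sqr_ge0 w)) (ltW h2).
  lra.
pose G := g @` [set` `]0%R, 1%R]].
have gH l : 0 < l <= 1 -> hill_region mu c (g l).
  move=> l01; have [l0 l1] := andP l01.
  have r1 : 0 < sqnorm (l * u) (l * w) by rewrite rE mulr_gt0 ?exprn_gt0.
  apply/hill_regionP; rewrite gE; split.
  - move=> E; have := lc_point_earth mu (l * u) (l * w).
    rewrite E subrr (enorm2 (0 : 'rV[R]_2)) !mxE expr0n/= addr0 sqrtr0 => z0.
    by move: r1; rewrite -z0 ltxx.
  - move=> E; have := lc_point_moon mu (l * u) (l * w).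
    rewrite E subrr (enorm2 (0 : 'rV[R]_2)) !mxE expr0n/= addr0 sqrtr0 => z0.
    have := @moon_dist_gt0 R (l * u) (l * w); rewrite -z0 ltxx => h.
    have : false by apply: h; have := rl l; rewrite (ltW l0) l1 => /(_ isT); rewrite /sqnorm; have := sqr_ge0 (l * u); lra.
    by [].
  - rewrite -subr_le0 potential_lc ?gt_eqF// mulr_le0_ge0 ?invr_ge0 ?(ltW r1)//.
    exact: Wl.
have GC : G `<=` connected_component (hill_region mu c) (lc_point mu u w).
  apply: connected_component_max.
  - exists 1; first by rewrite /= in_itv/= ltr01 lexx.
    by rewrite gE !mul1r.
  - by move=> _ [l /= + <-]; rewrite in_itv/= => l01; exact: gH.
  - apply: connected_continuous_connected; last exact: continuous_subspaceT.
    by apply/connected_intervalP; exact: interval_is_interval.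
have g0 : g 0 = position mu Earth by rewrite /g mul0r scale0r addr0.
move=> B; rewrite -g0 => /(cg 0) [e /= e0 eB].
pose l := Num.min 1 (e / 2).
have l0 : 0 < l by rewrite lt_min ltr01 divr_gt0.
have l1 : l <= 1 by rewrite ge_min lexx.
have le : l <= e / 2 by rewrite ge_min lexx orbT.
exists (g l); split.
  by apply: GC; exists l => //=; rewrite in_itv/= l0.
by apply: eB; rewrite /ball_/= sub0r normrN gtr0_norm//; lra.
Qed.

Lemma hill_component_lc u w : 0 < sqnorm u w < t ->
  lc_potential mu (mu * (1 - mu) / 2 - c) u w <= 0 ->
  hill_component mu c Earth (lc_point mu u w).
Proof.
move=> /andP[r0 rt] W0.
have cl : closure (connected_component (hill_region mu c) (lc_point mu u w)) (position mu Earth).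
  by apply: hill_component_closure => //; rewrite r0 ltW.
split => //.
- have [q [Cq _]] := cl _ filterT.
  apply: contrapT => /connected_component_out E.
  by move: Cq; rewrite E.
- by apply: hill_component_bounded; rewrite lc_point_earth.
Qed.

End HillRegion.

(** * Moser regularization *)

Section RowCurves.
Context {R : realType}.

Lemma is_deriveP (V : normedModType R) (f : R -> V) (x : R) (d : V) :
  is_derive x 1 f d <-> h^-1 *: (f (h + x) - f x) @[h --> 0^'] --> d.
Proof.
have E : (fun h : R => h^-1 *: ((f \o shift x) (h *: 1) - f x)) =
         (fun h : R => h^-1 *: (f (h + x) - f x)).
  by apply/funext => h /=; rewrite [_%:A]mulr1.
split=> [[df <-]|df].
  by move: df; rewrite /derive /derivable E.
split; first by rewrite /derivable E; apply/cvg_ex; exists d.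
by rewrite /derive E; exact: cvg_lim.
Qed.

Lemma is_derive_comp_linear (V W : normedModType R) (L : V -> W) (f : R -> V) (x : R) (d : V) :
  (forall a v w, L (a *: (v - w)) = a *: (L v - L w)) -> {for d, continuous L} ->
  is_derive x 1 f d -> is_derive x 1 (fun s => L (f s)) (L d).
Proof.
move=> linL cL /is_deriveP df; apply/is_deriveP.
under eq_fun do rewrite -linL.
exact: (cvg_comp _ _ df cL).
Qed.

Lemma is_derive_pair (V W : normedModType R) (f : R -> V) (g : R -> W) (x : R) (d : V) (e : W) :
  is_derive x 1 f d -> is_derive x 1 g e -> is_derive x 1 (fun s => (f s, g s)) (d, e).
Proof.
move=> /is_deriveP df /is_deriveP dg; apply/is_deriveP.
exact: (cvg_pair df dg).
Qed.

Lemma der_entry1 n (s : R -> 'rV[R]_n * 'rV[R]_n) (x : R) v i :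
  is_derive x (1 : R) s v -> has_deriv (fun t => (s t).1 0 i) x (v.1 0 i).
Proof.
apply: (is_derive_comp_linear (L := fun z : 'rV[R]_n * 'rV[R]_n => z.1 0 i)).
  by move=> a y z /=; rewrite !mxE.
apply: (continuous_comp (f := fst) (g := fun M : 'rV[R]_n => M 0 i)); first exact: cvg_fst.
exact: coord_continuous.
Qed.

Lemma der_entry2 n (s : R -> 'rV[R]_n * 'rV[R]_n) (x : R) v i :
  is_derive x (1 : R) s v -> has_deriv (fun t => (s t).2 0 i) x (v.2 0 i).
Proof.
apply: (is_derive_comp_linear (L := fun z : 'rV[R]_n * 'rV[R]_n => z.2 0 i)).
  by move=> a y z /=; rewrite !mxE.
apply: (continuous_comp (f := snd) (g := fun M : 'rV[R]_n => M 0 i)); first exact: cvg_snd.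
exact: coord_continuous.
Qed.

Lemma is_derive_row n (M : R -> 'rV[R]_n) (x : R) (d : 'rV[R]_n) :
  (forall i, has_deriv (fun t => M t 0 i) x (d 0 i)) -> is_derive x (1 : R) M d.
Proof.
move=> Md; have dM : derivable M x 1.
  by apply/derivable_mxP => i j; rewrite ord1; case: (Md j).
split => //; rewrite derive_mx//; apply/rowP => j; rewrite mxE.
by case: (Md j).
Qed.

Lemma continuous_row n (M : R -> 'rV[R]_n) :
  (forall i, continuous (fun t => M t 0 i)) -> continuous M.
Proof.
move=> cM x; apply/cvgrPdist_le => e e0; near=> y.
rewrite /Num.Def.normr/= mx_normrE (bigmax_le _ (ltW e0))//= => -[i j] _ /=.
rewrite ord1 !mxE; move: j; near: y; apply: filter_forall => j.
exact: ((cvgrPdist_le _ _).1 (cM j x)).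
Unshelve. all: by end_near. Qed.

Definition C1 (f : R -> R) := exists df, (forall x, has_deriv f x (df x)) /\ (forall x, cont_at df x).

Lemma C1_cont f x : C1 f -> cont_at f x.
Proof. by move=> [df [fdf _]]; exact: der_cont (fdf x). Qed.

Lemma C1C c : C1 (fun=> c).
Proof. by exists (fun=> 0); split => [x|x]; [exact: derC|exact: catC]. Qed.

Lemma C1D f g : C1 f -> C1 g -> C1 (fun x => f x + g x).
Proof.
move=> [df [fdf cdf]] [dg [gdg cdg]]; exists (fun x => df x + dg x).
by split => x; [exact: derD|exact: catD].
Qed.

Lemma C1N f : C1 f -> C1 (fun x => - f x).
Proof. by move=> [df [fdf cdf]]; exists (fun x => - df x); split => x; [exact: derN|exact: catN]. Qed.

Lemma C1M f g : C1 f -> C1 g -> C1 (fun x => f x * g x).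
Proof.
move=> Cf Cg; have [df [fdf cdf]] := Cf; have [dg [gdg cdg]] := Cg.
exists (fun x => df x * g x + f x * dg x); split => x; first exact: derM.
by apply: catD; apply: catM => //; exact: C1_cont.
Qed.

Lemma C1X f n : C1 f -> C1 (fun x => f x ^+ n.+1).
Proof.
move=> Cf; have [df [fdf cdf]] := Cf; exists (fun x => n.+1%:R * f x ^+ n * df x).
split => x; first exact: derX.
by apply: catM => //; apply: catM; [exact: catC|apply: catX; exact: C1_cont].
Qed.

Lemma C1V f : (forall x, f x != 0) -> C1 f -> C1 (fun x => (f x)^-1).
Proof.
move=> f0 Cf; have [df [fdf cdf]] := Cf; exists (fun x => - df x / f x ^+ 2).
split => x; first exact: derV.
apply: catM; first exact: catN.
by apply: catV; [rewrite expf_neq0|apply: catX; exact: C1_cont].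
Qed.

End RowCurves.

(** * The stereographic chart of the cotangent sphere *)

Section Moser.
Context {R : realType}.
Implicit Types (mu : R) (q p : 'rV[R]_2) (z u v : 'rV[R]_3 * 'rV[R]_3).

Definition cons_row (a : R) (f : 'I_2 -> R) : 'rV[R]_3 :=
  \row_(i < 3) (if unlift 0 i is Some k then f k else a).

Lemma cons_row0 a f : cons_row a f 0 0 = a.
Proof. by rewrite mxE unlift_none. Qed.

Lemma cons_row_lift a f k : cons_row a f 0 (lift 0 k) = f k.
Proof. by rewrite mxE liftK. Qed.

Lemma dot3 (v w : 'rV[R]_3) : dot v w = v 0 0 * w 0 0 +
  (v 0 (lift 0 0) * w 0 (lift 0 0) + v 0 (lift 0 1) * w 0 (lift 0 1)).
Proof. by rewrite /dot !big_ord_recl big_ord0 addr0 ord1_lift. Qed.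

Lemma forall_ord2 (P : 'I_2 -> Prop) : P 0 -> P 1 -> forall k, P k.
Proof.
move=> P0 P1 [[|[|//]] i]; first by rewrite (_ : Ordinal i = 0)//; exact: val_inj.
by rewrite (_ : Ordinal i = 1)//; exact: val_inj.
Qed.

(** The equations of [moser_graph] solved for [(xi, eta)]: inverse stereographic projection of
    [x = - p] with [X = |x|^2 + 1], and its cotangent lift, for which [eta_0 = x . y]. *)
Definition moser mu q p : 'rV[R]_3 * 'rV[R]_3 :=
  let X := p 0 0 ^+ 2 + p 0 1 ^+ 2 + 1 in
  let y := q - position mu Earth in
  let e := - (p 0 0 * y 0 0 + p 0 1 * y 0 1) in
  (cons_row ((X - 2) / X) (fun k => - (2 * p 0 k) / X),
   cons_row e (fun k => X / 2 * y 0 k + e * p 0 k)).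

Lemma moser_graphP mu q p : moser_graph mu Earth (q, p) (moser mu q p).
Proof.
have X0 : p 0 0 ^+ 2 + p 0 1 ^+ 2 + 1 != 0.
  by rewrite gt_eqF// ltr_wpDl// addr_ge0 ?sqr_ge0.
have n2 : 1 - (p 0 0 ^+ 2 + p 0 1 ^+ 2 + 1 - 2) / (p 0 0 ^+ 2 + p 0 1 ^+ 2 + 1) =
    2 / (p 0 0 ^+ 2 + p 0 1 ^+ 2 + 1) by field.
have n1 : ((p 0 0 ^+ 2 + p 0 1 ^+ 2 + 1 - 2) / (p 0 0 ^+ 2 + p 0 1 ^+ 2 + 1) : R) <> 1.
  by move=> E; move/esym/eqP: n2; rewrite E subrr mulf_eq0 invr_eq0 (negPf X0) pnatr_eq0.
split.
- split; rewrite dot3 /moser /= !cons_row0 !cons_row_lift; field; exact: X0.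
- by rewrite /moser /= cons_row0.
- move=> k; rewrite /moser /= !cons_row0 !cons_row_lift n2 !mxE.
  by split; field.
Qed.

Definition stereo_x z (k : 'I_2) : R := z.1 0 (lift 0 k) / (1 - z.1 0 0).
Definition stereo_y z (k : 'I_2) : R :=
  z.2 0 (lift 0 k) * (1 - z.1 0 0) + z.1 0 (lift 0 k) * z.2 0 0.

Definition stereo_dx z v (k : 'I_2) : R :=
  v.1 0 (lift 0 k) / (1 - z.1 0 0) + z.1 0 (lift 0 k) * v.1 0 0 / (1 - z.1 0 0) ^+ 2.
Definition stereo_dy z v (k : 'I_2) : R :=
  v.2 0 (lift 0 k) * (1 - z.1 0 0) - z.2 0 (lift 0 k) * v.1 0 0 +
  v.1 0 (lift 0 k) * z.2 0 0 + z.1 0 (lift 0 k) * v.2 0 0.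

Lemma der_stereo_x (s : R -> 'rV[R]_3 * 'rV[R]_3) (t : R) v k : (s t).1 0 0 <> 1 ->
  is_derive t (1 : R) s v -> has_deriv (fun r => stereo_x (s r) k) t (stereo_dx (s t) v k).
Proof.
move=> s1 ds; have n0 : 1 - (s t).1 0 0 != 0 by rewrite subr_eq0 eq_sym; apply/eqP.
have := derM (der_entry1 (lift 0 k) ds) (derV (f := fun r => 1 - (s r).1 0 0) n0
  (derD (derC 1 t) (derN (der_entry1 0 ds)))).
by move=> h; apply: (der_eq h) => //; rewrite /stereo_dx; field.
Qed.

Lemma der_stereo_y (s : R -> 'rV[R]_3 * 'rV[R]_3) (t : R) v k :
  is_derive t (1 : R) s v -> has_deriv (fun r => stereo_y (s r) k) t (stereo_dy (s t) v k).
Proof.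
move=> ds; have := derD (derM (der_entry2 (lift 0 k) ds) (derD (derC 1 t) (derN (der_entry1 0 ds))))
  (derM (der_entry1 (lift 0 k) ds) (der_entry2 0 ds)).
by move=> h; apply: (der_eq h) => //; rewrite /stereo_dy; ring.
Qed.

Definition tangent_vector z v := dot z.1 v.1 = 0 /\ dot v.1 z.2 + dot z.1 v.2 = 0.

(* The cotangent lift of the stereographic projection is symplectic: the difference of
   the two sides is a combination of the equations defining T T^*S^2. *)
Lemma stereo_symplectic z u v : dot z.1 z.1 = 1 -> z.1 0 0 <> 1 ->
  tangent_vector z u -> tangent_vector z v ->
  symplectic_form u v =
    (stereo_dy z u 0 * stereo_dx z v 0 + stereo_dy z u 1 * stereo_dx z v 1) -
    (stereo_dy z v 0 * stereo_dx z u 0 + stereo_dy z v 1 * stereo_dx z u 1).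
Proof.
rewrite /tangent_vector /symplectic_form !dot3 /stereo_dx /stereo_dy.
move: z u v => [xi eta] [a b] [a' b'] /=.
move: (xi 0 0) (xi 0 (lift 0 0)) (xi 0 (lift 0 1)) => x0 x1 x2.
move: (eta 0 0) (eta 0 (lift 0 0)) (eta 0 (lift 0 1)) => e0 e1 e2.
move: (a 0 0) (a 0 (lift 0 0)) (a 0 (lift 0 1)) => a0 a1 a2.
move: (b 0 0) (b 0 (lift 0 0)) (b 0 (lift 0 1)) => b0 b1 b2.
move: (a' 0 0) (a' 0 (lift 0 0)) (a' 0 (lift 0 1)) => c0 c1 c2.
move: (b' 0 0) (b' 0 (lift 0 0)) (b' 0 (lift 0 1)) => d0 d1 d2.
move=> S1 x01 [Tu1 Tu2] [Tv1 Tv2].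
have n0 : 1 - x0 != 0 by rewrite subr_eq0 eq_sym; apply/eqP.
apply/eqP; rewrite eq_sym -subr_eq0; apply/eqP.
transitivity (c0 / (1 - x0) * (a0 * e0 + (a1 * e1 + a2 * e2) + (x0 * b0 + (x1 * b1 + x2 * b2)))
  - a0 / (1 - x0) * (c0 * e0 + (c1 * e1 + c2 * e2) + (x0 * d0 + (x1 * d1 + x2 * d2)))
  + (e0 * c0 / (1 - x0) ^+ 2 - d0 / (1 - x0)) * (x0 * a0 + (x1 * a1 + x2 * a2))
  - (e0 * a0 / (1 - x0) ^+ 2 - b0 / (1 - x0)) * (x0 * c0 + (x1 * c1 + x2 * c2))
  + (b0 * c0 - d0 * a0) / (1 - x0) ^+ 2 * (x0 * x0 + (x1 * x1 + x2 * x2) - 1)); first by field.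
by rewrite Tu2 Tv2 Tu1 Tv1 S1; ring.
Qed.

End Moser.

(** * The Hamiltonian in the chart and tangent vectors of the regularized surface *)

Section RegularizedEnergy.
Context {R : realType}.
Variables (mu c : R).
Notation amb := ('rV[R]_3 * 'rV[R]_3)%type.
Implicit Types (z v : amb).

Definition stereo_earth_dist z : R := Num.sqrt (stereo_y z 0 ^+ 2 + stereo_y z 1 ^+ 2).
Definition stereo_moon_dist z : R := Num.sqrt ((1 + stereo_y z 0) ^+ 2 + stereo_y z 1 ^+ 2).

Definition stereo_energy z : R :=
  2^-1 * ((stereo_y z 1 - stereo_x z 0) ^+ 2 + (stereo_x z 1 + mu + stereo_y z 0) ^+ 2) +
  (mu * (1 - mu) / 2 - (1 - mu) * tidal (stereo_earth_dist z) - mu * tidal (stereo_moon_dist z)).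

Lemma moser_graph_stereo (w : 'rV[R]_2 * 'rV[R]_2) z : moser_graph mu Earth w z ->
  (forall k, stereo_x z k = - w.2 0 k) /\
  (forall k, stereo_y z k = (w.1 - position mu Earth) 0 k).
Proof.
move=> [_ _ H]; split => k; have [+ +] := H k; rewrite /stereo_x /stereo_y.
  by move=> <- _; rewrite mxE.
by move=> _ <-.
Qed.

Lemma stereo_energy_graph w z : moser_graph mu Earth w z -> stereo_energy z = hamiltonian mu w.
Proof.
case: w => q p /moser_graph_stereo[/= hx hy].
rewrite hamiltonianE potentialE (enorm_earth mu) enorm_moon /stereo_energy /stereo_earth_dist /stereo_moon_dist.
rewrite !hx !hy !mxE /= subr0.
by congr (_ + _); congr (_ * _); ring.
Qed.

Definition regular z := [/\ z.1 0 0 <> 1, stereo_earth_dist z <> 0 & stereo_moon_dist z <> 0].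

Lemma cat_fst_entry i z : cont_at (fun z : amb => z.1 0 i) z.
Proof.
apply: (continuous_comp (f := fst) (g := fun M : 'rV[R]_3 => M 0 i)); first exact: cvg_fst.
exact: coord_continuous.
Qed.

Lemma cat_snd_entry i z : cont_at (fun z : amb => z.2 0 i) z.
Proof.
apply: (continuous_comp (f := snd) (g := fun M : 'rV[R]_3 => M 0 i)); first exact: cvg_snd.
exact: coord_continuous.
Qed.

Lemma cat_stereo_y k z : cont_at (fun z => stereo_y z k) z.
Proof.
apply: catD; apply: catM; [exact: cat_snd_entry| |exact: cat_fst_entry|exact: cat_snd_entry].
by apply: catD; [exact: catC|apply: catN; exact: cat_fst_entry].
Qed.

Lemma cat_stereo_x k z : z.1 0 0 <> 1 -> cont_at (fun z => stereo_x z k) z.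
Proof.
move=> z1; apply: catM; first exact: cat_fst_entry.
apply: (catV (f := fun z : amb => 1 - z.1 0 0)); first by rewrite subr_eq0 eq_sym; apply/eqP.
by apply: catD; [exact: catC|apply: catN; exact: cat_fst_entry].
Qed.

Lemma cat_stereo_earth_dist z : cont_at stereo_earth_dist z.
Proof. by apply: cat_sqrt; apply: catD; apply: catX; exact: cat_stereo_y. Qed.

Lemma cat_stereo_moon_dist z : cont_at stereo_moon_dist z.
Proof.
apply: cat_sqrt; apply: catD; apply: catX; last exact: cat_stereo_y.
by apply: catD; [exact: catC|exact: cat_stereo_y].
Qed.

Lemma cat_stereo_energy z : regular z -> cont_at stereo_energy z.
Proof.
move=> [z1 /eqP zE /eqP zM]; have cx k := cat_stereo_x (k := k) z1; have cy := cat_stereo_y.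
apply: catD; last first.
  apply: catD; last by apply: catN; apply: catM; [exact: catC|apply: cat_tidal => //; exact: cat_stereo_moon_dist].
  apply: catD; first exact: catC.
  by apply: catN; apply: catM; [exact: catC|apply: cat_tidal => //; exact: cat_stereo_earth_dist].
apply: catM; first exact: catC.
apply: catD; apply: catX; first by apply: catD; [exact: cy|apply: catN; exact: cx].
by apply: catD; [apply: catD; [exact: cx|exact: catC]|exact: cy].
Qed.

(** The surface is a closure, so its points need not come from the energy surface; continuity of the
    energy at regular points carries the value [c] to the limit. *)
Lemma regularized_surface_energy z : regularized_surface mu c Earth z -> regular z ->
  stereo_energy z = c.
Proof.
move=> [_ cl] reg; apply/eqP; apply/negPn/negP => zc.
have e0 : 0 < `|stereo_energy z - c| by rewrite normr_gt0 subr_eq0.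
have /cvgrPdist_lt/(_ _ e0) := cat_stereo_energy reg.
move=> /cl [z' [[w [[_ _ wc] _] wz'] h]].
by move: h => /=; rewrite (stereo_energy_graph wz') wc ltxx.
Qed.

Lemma tangent_space_tangent_vector z v : tangent_space (regularized_surface mu c Earth) z v ->
  tangent_vector z v.
Proof.
move=> [s [s0 Ss ds]].
have d1 i := der_entry1 i ds; have d2 i := der_entry2 i ds.
have sphere := derD (derM (d1 0) (d1 0))
  (derD (derM (d1 (lift 0 0)) (d1 (lift 0 0))) (derM (d1 (lift 0 1)) (d1 (lift 0 1)))).
have ortho := derD (derM (d1 0) (d2 0))
  (derD (derM (d1 (lift 0 0)) (d2 (lift 0 0))) (derM (d1 (lift 0 1)) (d2 (lift 0 1)))).
have sphere0 : has_deriv (fun r => (s r).1 0 0 * (s r).1 0 0 +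
   ((s r).1 0 (lift 0 0) * (s r).1 0 (lift 0 0) + (s r).1 0 (lift 0 1) * (s r).1 0 (lift 0 1))) 0 0.
  apply: near_eq_is_derive (derC 1 0); apply: filterS Ss => r [[+ _] _].
  by rewrite dot3.
have ortho0 : has_deriv (fun r => (s r).1 0 0 * (s r).2 0 0 +
   ((s r).1 0 (lift 0 0) * (s r).2 0 (lift 0 0) + (s r).1 0 (lift 0 1) * (s r).2 0 (lift 0 1))) 0 0.
  apply: near_eq_is_derive (derC 0 0); apply: filterS Ss => r [[_ +] _].
  by rewrite dot3.
have := der_unique sphere sphere0; have := der_unique ortho ortho0; rewrite s0.
by split; rewrite !dot3; lra.
Qed.

Definition energy_diff z v : R :=
  (stereo_y z 1 - stereo_x z 0) * (stereo_dy z v 1 - stereo_dx z v 0) +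
  (stereo_x z 1 + mu + stereo_y z 0) * (stereo_dx z v 1 + stereo_dy z v 0) -
  (1 - mu) * (1 - stereo_earth_dist z ^- 3) *
    (stereo_y z 0 * stereo_dy z v 0 + stereo_y z 1 * stereo_dy z v 1) -
  mu * (1 - stereo_moon_dist z ^- 3) *
    ((1 + stereo_y z 0) * stereo_dy z v 0 + stereo_y z 1 * stereo_dy z v 1).

(** Regularity is an open condition, so a curve in the surface has constant energy for short times;
    the chain rule expresses the derivative through [energy_diff]. *)
Lemma tangent_space_energy z v : regular z ->
  tangent_space (regularized_surface mu c Earth) z v -> energy_diff z v = 0.
Proof.
move=> reg [s [s0 Ss ds]]; have [z1 zE zM] := reg.
have sz1 : (s 0).1 0 0 <> 1 by rewrite s0.
have dx k := der_stereo_x k sz1 ds; have dy k := der_stereo_y k ds.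
have pE : 0 < stereo_y (s 0) 0 ^+ 2 + stereo_y (s 0) 1 ^+ 2.
  by rewrite s0 -sqrtr_gt0 lt_def sqrtr_ge0 andbT; apply/eqP.
have pM : 0 < (1 + stereo_y (s 0) 0) ^+ 2 + stereo_y (s 0) 1 ^+ 2.
  by rewrite s0 -sqrtr_gt0 lt_def sqrtr_ge0 andbT; apply/eqP.
have dE := derSqrt (f := fun r => stereo_y (s r) 0 ^+ 2 + stereo_y (s r) 1 ^+ 2) pE
  (derD (derX 1 (dy 0)) (derX 1 (dy 1))).
have dM := derSqrt (f := fun r => (1 + stereo_y (s r) 0) ^+ 2 + stereo_y (s r) 1 ^+ 2) pM
  (derD (derX 1 (derD (derC 1 0) (dy 0))) (derX 1 (dy 1))).
have nE : stereo_earth_dist (s 0) != 0 by rewrite s0; apply/eqP.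
have nM : stereo_moon_dist (s 0) != 0 by rewrite s0; apply/eqP.
have tE := der_tidal (f := fun r => stereo_earth_dist (s r)) nE dE.
have tM := der_tidal (f := fun r => stereo_moon_dist (s r)) nM dM.
have kin := derD (derX 1 (derD (dy 1) (derN (dx 0))))
   (derX 1 (derD (derD (dx 1) (derC mu 0)) (dy 0))).
have tot := derD (derM (derC 2^-1 0) kin) (derD (derD (derC (mu * (1 - mu) / 2) 0)
  (derN (derM (derC (1 - mu) 0) tE))) (derN (derM (derC mu 0) tM))).
have const : has_deriv (fun r => stereo_energy (s r)) 0 0.
  apply: near_eq_is_derive (derC c 0).
  have r1 := near_neq (der_cont (der_entry1 0 ds)) sz1.
  have r2 := near_neq (der_cont dE) (elimN eqP nE).
  have r3 := near_neq (der_cont dM) (elimN eqP nM).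
  near=> r; symmetry; apply: regularized_surface_energy; first by near: r.
  by split; near: r.
have := der_unique tot const; rewrite -!/(stereo_earth_dist _) -!/(stereo_moon_dist _) !s0.
rewrite s0 in nE nM.
move=> <-; rewrite /energy_diff; field.
by rewrite nE nM.
Unshelve. all: by end_near. Qed.

End RegularizedEnergy.

Section Periodicity.
Context {R : realType}.

Lemma periodic_forall (Q : R -> Prop) (T : R) : 0 < T -> (forall s, Q (s + T) <-> Q s) ->
  (forall s, 0 <= s < T -> Q s) -> forall s, Q s.
Proof.
move=> T0 QT Q0.
have Qn (n : nat) s : Q (s + n%:R * T) <-> Q s.
  elim: n => [|n IH]; first by rewrite mul0r addr0.
  by rewrite -natr1 mulrDl mul1r addrA; split=> [/QT/IH|/IH/QT].
move=> s; pose f := Num.floor (s / T).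
have [/= fl fu] : f%:~R * T <= s /\ s < (f%:~R + 1) * T.
  rewrite -ler_pdivlMr// -ltr_pdivrMr//.
  by have := floor_le_tmp (s / T); have := floorD1_gt (s / T); rewrite intrD.
have base : Q (s - f%:~R * T) by apply: Q0; move: fl fu; rewrite mulrDl mul1r; lra.
case: f base {fl fu} => n.
  by move=> /(Qn n); rewrite subrK.
rewrite NegzE intrN mulNr opprK => /(Qn n.+1).
exact.
Qed.

End Periodicity.

(** * The closed leaf carried by the retrograde orbit *)

Section ClosedLeaf.
Context {R : realType}.
Variables (mu c t : R).
Hypotheses (mu01 : 0 < mu < 1) (t01 : 0 < t < 1) (crit : critical_radius mu t).
Notation k := (mu * (1 - mu) / 2 - c).
Hypothesis kt : (1 - mu) * tidal t + mu * tidal (1 - t) < k.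
Variables (u w a b : R -> R) (T : R).
Hypothesis orbit : retrograde mu k t u w a b T.

Let T0 : 0 < T. Proof. by case: orbit. Qed.
Let du s : has_deriv u s (a s). Proof. by case: orbit => -[sol _] _ _ _ _; case: (sol s). Qed.
Let dw s : has_deriv w s (b s). Proof. by case: orbit => -[sol _] _ _ _ _; case: (sol s). Qed.
Let da s : has_deriv a s (acc_u mu k (u s) (w s) (b s)).
Proof. by case: orbit => -[sol _] _ _ _ _; case: (sol s). Qed.
Let db s : has_deriv b s (acc_w mu k (u s) (w s) (a s)).
Proof. by case: orbit => -[sol _] _ _ _ _; case: (sol s). Qed.
Let disc s : sqnorm (u s) (w s) < t.
Proof. by case: orbit => -[_ inv] _ _ _ _; case: (inv s). Qed.
Let en s : 2 * (a s ^+ 2 + b s ^+ 2) + lc_potential mu k (u s) (w s) = 0.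
Proof. by case: orbit => -[_ inv] _ _ _ _; case: (inv s). Qed.
Let before s : 0 <= s < T -> 0 < u s /\ b s < 0. Proof. by case: orbit => _ _ + _ _; apply. Qed.
Let after s : 0 < s <= T -> a s < 0 /\ w s < 0. Proof. by case: orbit => _ _ _ + _; apply. Qed.
Let w0 : w 0 = 0. Proof. by case: orbit => _ _ _ _ []. Qed.
Let uT : u T = 0. Proof. by case: orbit => _ _ _ _ []. Qed.
Let reverse s : [/\ u (- s) = u s, w (- s) = - w s, a (- s) = - a s & b (- s) = b s].
Proof. by case: orbit => _ _ _ _ [_ _ + _]; apply. Qed.
Let mirror s : [/\ u (2 * T - s) = - u s, w (2 * T - s) = w s, a (2 * T - s) = a s
  & b (2 * T - s) = - b s].
Proof. by case: orbit => _ _ _ _ [_ _ _]; apply. Qed.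

(** The composition of the two reflections is a translation of time by [2 * T] together with z -> -
    z. *)
Let half_period s : [/\ u (s + 2 * T) = - u s, w (s + 2 * T) = - w s, a (s + 2 * T) = - a s
  & b (s + 2 * T) = - b s].
Proof.
have := mirror (- s); have [-> -> -> ->] := reverse s.
by rewrite opprK addrC.
Qed.

Let nondegenerate s : 0 < sqnorm (u s) (w s) /\ 0 < sqnorm (a s) (b s).
Proof.
have sq1 (x y : R) : x != 0 -> 0 < sqnorm x y.
  by move=> x0; rewrite ltr_pwDl ?sqr_ge0// exprn_even_gt0.
have sq2 (x y : R) : y != 0 -> 0 < sqnorm x y.
  by move=> x0; rewrite ltr_wpDl ?sqr_ge0// exprn_even_gt0.
have half r : 0 <= r <= T -> 0 < sqnorm (u r) (w r) /\ 0 < sqnorm (a r) (b r).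
  move=> /andP[r0]; rewrite le_eqVlt => /predU1P[->|rT].
    have TT : 0 < T <= T by rewrite T0 lexx.
    have [aT wT] := after TT.
    by split; [apply: sq2|apply: sq1]; rewrite lt_eqF.
  have rT' : 0 <= r < T by rewrite r0.
  have [ur br] := before rT'.
  by split; [apply: sq1; rewrite gt_eqF|apply: sq2; rewrite lt_eqF].
(* The sign change under [2 * T] does not affect [sqnorm], so one such interval suffices; its second
   half is the mirror image of the first. *)
move: s; apply: (@periodic_forall R _ (2 * T)); first by rewrite mulr_gt0.
  by move=> s; have [-> -> -> ->] := half_period s; rewrite /sqnorm !sqrrN.
move=> s /andP[s0 sT]; have [sT'|sT'] := leP s T; first by apply: half; rewrite s0.
have := half (2 * T - s); have [-> -> -> ->] := mirror s; rewrite /sqnorm !sqrrN.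
by apply; lra.
Qed.

Let r s := sqnorm (u s) (w s).
Let d s := moon_dist (u s) (w s).
Let X s := u s ^+ 2 - w s ^+ 2.
Let Y s := 2 * u s * w s.
(** The velocity [2 z z' / r] of q in the original time, since q - E = z^2 and dt = r ds. [Ux] and
    [Uy] are the components of grad U. *)
Let vx s := 2 * (u s * a s - w s * b s) / r s.
Let vy s := 2 * (u s * b s + w s * a s) / r s.
Let Ux s := - (1 - mu) * (1 - r s ^- 3) * X s - mu * (1 - d s ^- 3) * (1 + X s).
Let Uy s := - (1 - mu) * (1 - r s ^- 3) * Y s - mu * (1 - d s ^- 3) * Y s.

Let r0 s : r s != 0. Proof. by rewrite gt_eqF//; case: (nondegenerate s). Qed.
Let d_gt0 s : 0 < d s.
Proof.
apply: moon_dist_gt0; have := disc s; have [_ t1] := andP t01.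
by rewrite /sqnorm; have := sqr_ge0 (u s); lra.
Qed.
Let d0 s : d s != 0. Proof. by rewrite gt_eqF. Qed.

Let dr s : has_deriv r s (2 * (u s * a s + w s * b s)).
Proof. by apply: (der_eq (derD (derX 1 (du s)) (derX 1 (dw s)))) => //; ring. Qed.

Let dX s : has_deriv X s (r s * vx s).
Proof.
apply: (der_eq (derD (derX 1 (du s)) (derN (derX 1 (dw s))))) => //.
by rewrite /vx; field; exact: r0.
Qed.

Let dY s : has_deriv Y s (r s * vy s).
Proof.
apply: (der_eq (derM (derM (derC 2 s) (du s)) (dw s))) => //.
by rewrite /vy; field; exact: r0.
Qed.

(** With [dvy], the rotating-frame equations of motion, multiplied by [r] for the change of time. *)
Let dvx s : has_deriv vx s (r s * (2 * vy s - Ux s)).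
Proof.
apply: (der_eq (derM (derM (derC 2 s) (derD (derM (du s) (da s)) (derN (derM (dw s) (db s)))))
  (derV (r0 s) (dr s)))) => //.
(* The two sides differ by a multiple of the energy, which vanishes. *)
transitivity (r s * (2 * vy s - Ux s) -
  (2 * (a s ^+ 2 + b s ^+ 2) + lc_potential mu k (u s) (w s)) * X s / r s ^+ 2); last first.
  by rewrite en mul0r mul0r subr0.
have r0s := r0 s; have d0s := d0 s; rewrite /vy /Ux /X /acc_u /acc_w /lc_slope /lc_potential /tidal.
rewrite -/(d s) -/(r s); move: (d s) d0s => dd dd0.
have rE : r s = u s ^+ 2 + w s ^+ 2 by [].
rewrite rE in r0s *; move: (u s) (w s) (a s) (b s) r0s => u1 w1 a1 b1 r0s.
by field; rewrite r0s dd0.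
Qed.

Let dvy s : has_deriv vy s (r s * (- 2 * vx s - Uy s)).
Proof.
apply: (der_eq (derM (derM (derC 2 s) (derD (derM (du s) (db s)) (derM (dw s) (da s))))
  (derV (r0 s) (dr s)))) => //.
transitivity (r s * (- 2 * vx s - Uy s) -
  (2 * (a s ^+ 2 + b s ^+ 2) + lc_potential mu k (u s) (w s)) * Y s / r s ^+ 2); last first.
  by rewrite en mul0r mul0r subr0.
have r0s := r0 s; have d0s := d0 s; rewrite /vx /Uy /Y /acc_u /acc_w /lc_slope /lc_potential /tidal.
rewrite -/(d s) -/(r s); move: (d s) d0s => dd dd0.
have rE : r s = u s ^+ 2 + w s ^+ 2 by [].
rewrite rE in r0s *; move: (u s) (w s) (a s) (b s) r0s => u1 w1 a1 b1 r0s.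
by field; rewrite r0s dd0.
Qed.

Let q s := lc_point mu (u s) (w s).
(** The momenta for which [p1 + q2] and [p2 - q1] are the velocities. *)
Let p s : 'rV[R]_2 := vec2 (vx s - Y s) (vy s + (mu + X s)).
Let g s := moser mu (q s) (p s).

Let energy_qp s : hamiltonian mu (q s, p s) = c.
Proof.
rewrite hamiltonianE !vec2_0 !vec2_1 -/(X s) -/(Y s) subrK addrK.
have := potential_lc mu c (r0 s) => /(canRL (subrK _)) ->.
have -> : lc_potential mu k (u s) (w s) = - (2 * (a s ^+ 2 + b s ^+ 2)).
  by move: (en s); lra.
rewrite /vx /vy; have := r0 s; rewrite /r /sqnorm.
by move: (u s) (w s) (a s) (b s) => u1 w1 a1 b1 n0; field.
Qed.

Let hill_q s : hill_component mu c Earth (q s).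
Proof.
apply: (hill_component_lc mu01 t01 crit kt); first by rewrite disc andbT; case: (nondegenerate s).
by have := en s; have := sqr_ge0 (a s); have := sqr_ge0 (b s); lra.
Qed.

Let surface_g s : regularized_surface mu c Earth (g s).
Proof.
have graph := moser_graphP mu (q s) (p s).
split; first by case: graph.
apply: subset_closure; exists (q s, p s) => //; split => //=.
by have [/hill_regionP[qE qM _] _ _] := hill_q s; split => //=; exact: energy_qp.
Qed.

Let stereo_x0 s : stereo_x (g s) 0 = - (vx s - Y s).
Proof. by have [-> _] := moser_graph_stereo (moser_graphP mu (q s) (p s)); rewrite vec2_0. Qed.

Let stereo_x1 s : stereo_x (g s) 1 = - (vy s + (mu + X s)).
Proof. by have [-> _] := moser_graph_stereo (moser_graphP mu (q s) (p s)); rewrite vec2_1. Qed.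

Let stereo_y0 s : stereo_y (g s) 0 = X s.
Proof.
have [_ ->] := moser_graph_stereo (moser_graphP mu (q s) (p s)).
by rewrite /= !mxE /= addrAC subrr add0r.
Qed.

Let stereo_y1 s : stereo_y (g s) 1 = Y s.
Proof.
have [_ ->] := moser_graph_stereo (moser_graphP mu (q s) (p s)).
by rewrite /= !mxE /= subr0.
Qed.

Let earth_g s : stereo_earth_dist (g s) = r s.
Proof.
rewrite /stereo_earth_dist stereo_y0 stereo_y1 -[r s](lc_point_earth mu) (enorm_earth mu) vec2_0 vec2_1.
by rewrite [mu + _]addrC addrK.
Qed.

Let moon_g s : stereo_moon_dist (g s) = d s.
Proof.
rewrite /stereo_moon_dist stereo_y0 stereo_y1 -[d s](lc_point_moon mu) enorm_moon vec2_0 vec2_1.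
by rewrite [mu + _]addrC addrK.
Qed.

Let regular_g s : regular (g s).
Proof.
split; first by case: (moser_graphP mu (q s) (p s)).
- by rewrite earth_g; apply/eqP; exact: r0.
- by rewrite moon_g; apply/eqP; exact: d0.
Qed.

Let cu s : cont_at u s. Proof. exact: der_cont (du s). Qed.
Let cw s : cont_at w s. Proof. exact: der_cont (dw s). Qed.
Let ca s : cont_at a s. Proof. exact: der_cont (da s). Qed.
Let cb s : cont_at b s. Proof. exact: der_cont (db s). Qed.

Let cr s : cont_at r s. Proof. exact: der_cont (dr s). Qed.

Let cd s : cont_at d s.
Proof.
apply: cat_sqrt; apply: catD; apply: catX.
  by apply: catD; [apply: catD; [exact: catC|exact: catX]|apply: catN; exact: catX].
by apply: catM => //; apply: catM => //; exact: catC.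
Qed.

Let cslope e s : cont_at (fun s => lc_slope mu k e (u s) (w s)) s.
Proof.
apply: catD.
  by apply: catD; [exact: catC|apply: catN; apply: catM; [exact: catC|apply: catX; exact: cr]].
apply: catN; apply: catM; first exact: catC.
apply: catD; first by apply: (cat_tidal (f := d)); [exact: d0|exact: cd].
apply: catM; last first.
  by apply: catD; [apply: catX; exact: cr|apply: catM; [exact: catC|exact: cr]].
apply: catD; first exact: catC.
apply: catN; apply: (catV (f := fun s => d s ^+ 3)); first by rewrite expf_neq0.
by apply: catX; exact: cd.
Qed.

Let Cu : C1 u. Proof. by exists a. Qed.
Let Cw : C1 w. Proof. by exists b. Qed.

Let Ca : C1 a.
Proof.
exists (fun s => acc_u mu k (u s) (w s) (b s)); split => // s.
apply: catD; apply: catM => //; last by apply: catM; [exact: catC|exact: cr].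
by apply: catN; apply: catM => //; exact: catC.
Qed.

Let Cb : C1 b.
Proof.
exists (fun s => acc_w mu k (u s) (w s) (a s)); split => // s.
apply: catD; last by apply: catN; apply: catM => //; apply: catM; [exact: catC|exact: cr].
by apply: catM => //; apply: catN; apply: catM => //; exact: catC.
Qed.

Let CX : C1 X. Proof. by apply: C1D; [exact: C1X|apply: C1N; exact: C1X]. Qed.
Let CY : C1 Y. Proof. by apply: C1M => //; apply: C1M => //; exact: C1C. Qed.
Let Cr : C1 r. Proof. by apply: C1D; exact: C1X. Qed.

Let Cvx : C1 vx.
Proof.
apply: C1M; last by apply: C1V.
by apply: C1M; [exact: C1C|apply: C1D; [exact: C1M|apply: C1N; exact: C1M]].
Qed.

Let Cvy : C1 vy.
Proof.
apply: C1M; last by apply: C1V.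
by apply: C1M; [exact: C1C|apply: C1D; exact: C1M].
Qed.

Let Cp j : C1 (fun s => p s 0 j).
Proof.
move: j; apply: forall_ord2.
  rewrite (_ : (fun s => p s 0 0) = fun s => vx s - Y s); last by apply/funext => s; rewrite vec2_0.
  by apply: C1D => //; exact: C1N.
rewrite (_ : (fun s => p s 0 1) = fun s => vy s + (mu + X s)); last first.
  by apply/funext => s; rewrite vec2_1.
by apply: C1D => //; apply: C1D => //; exact: C1C.
Qed.

Let Cq j : C1 (fun s => (q s - position mu Earth) 0 j).
Proof.
move: j; apply: forall_ord2.
  rewrite (_ : (fun s => _) = X)//; apply/funext => s.
  by rewrite !mxE /= addrAC subrr add0r.
rewrite (_ : (fun s => _) = Y)//; apply/funext => s.
by rewrite !mxE /= subr0.
Qed.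

Let P s := p s 0 0 ^+ 2 + p s 0 1 ^+ 2 + 1.
Let P0 s : P s != 0. Proof. by rewrite gt_eqF// ltr_wpDl// addr_ge0 ?sqr_ge0. Qed.
Let CP : C1 P. Proof. by apply: C1D; [apply: C1D; apply: C1X; exact: Cp|exact: C1C]. Qed.
Let e s := - (p s 0 0 * (q s - position mu Earth) 0 0 + p s 0 1 * (q s - position mu Earth) 0 1).
Let Ce : C1 e.
Proof. by apply: C1N; apply: C1D; apply: C1M; [exact: Cp|exact: Cq|exact: Cp|exact: Cq]. Qed.

Let Cg1 i : C1 (fun s => (g s).1 0 i).
Proof.
case: (unliftP 0 i) => [j ->|->].
  rewrite (_ : (fun s => _) = fun s => - (2 * p s 0 j) / P s); last first.
    by apply/funext => s; rewrite /= cons_row_lift.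
  apply: C1M; last exact: C1V.
  by apply: C1N; apply: C1M; [exact: C1C|exact: Cp].
rewrite (_ : (fun s => _) = fun s => (P s - 2) / P s); last first.
  by apply/funext => s; rewrite /= cons_row0.
by apply: C1M; [apply: C1D => //; exact: C1C|exact: C1V].
Qed.

Let Cg2 i : C1 (fun s => (g s).2 0 i).
Proof.
case: (unliftP 0 i) => [j ->|->].
  rewrite (_ : (fun s => _) = fun s => P s / 2 * (q s - position mu Earth) 0 j + e s * p s 0 j); last first.
    by apply/funext => s; rewrite /= cons_row_lift.
  apply: (@C1D R (fun s => P s / 2 * (q s - position mu Earth) 0 j) (fun s => e s * p s 0 j)).
    by apply: (@C1M R (fun s => P s / 2)); [apply: C1M => //; exact: C1C|exact: Cq].
  by apply: C1M; [exact: Ce|exact: Cp].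
rewrite (_ : (fun s => _) = e)//.
by apply/funext => s; rewrite /= cons_row0.
Qed.

Let velocity : exists G : R -> ambient R,
  (forall s : R, is_derive s (1 : R) g (G s)) /\ continuous G.
Proof.
have [G1 HG1] := choice Cg1; have [G2 HG2] := choice Cg2.
exists (fun s => (\row_i G1 i s, \row_i G2 i s)); split.
  move=> s; have := @is_derive_pair R _ _ (fun s => (g s).1) (fun s => (g s).2) s
    (\row_i G1 i s) (\row_i G2 i s).
  apply.
  - by apply: is_derive_row => i; rewrite mxE; exact: (HG1 i).1.
  - by apply: is_derive_row => i; rewrite mxE; exact: (HG2 i).1.
have c1 : continuous (fun s => \row_i G1 i s : 'rV[R]_3).
  by apply: continuous_row => i; under eq_fun do rewrite mxE; exact: (HG1 i).2.
have c2 : continuous (fun s => \row_i G2 i s : 'rV[R]_3).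
  by apply: continuous_row => i; under eq_fun do rewrite mxE; exact: (HG2 i).2.
by move=> s; exact: (cvg_pair (c1 s) (c2 s)).
Qed.

Let velocity_stereo s G : is_derive s (1 : R) g G ->
  [/\ stereo_dx (g s) G 0 = - (r s * (vy s - Ux s)), stereo_dx (g s) G 1 = r s * (vx s + Uy s),
      stereo_dy (g s) G 0 = r s * vx s & stereo_dy (g s) G 1 = r s * vy s].
Proof.
move=> dg; have [g1 _ _] := regular_g s.
have := der_stereo_y 1 dg; have := der_stereo_y 0 dg.
have := der_stereo_x 1 g1 dg; have := der_stereo_x 0 g1 dg.
rewrite (_ : (fun r => stereo_x (g r) 0) = fun r => - (vx r - Y r)); last exact/funext.
rewrite (_ : (fun r => stereo_x (g r) 1) = fun r => - (vy r + (mu + X r))); last exact/funext.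
rewrite (_ : (fun r => stereo_y (g r) 0) = X); last exact/funext.
rewrite (_ : (fun r => stereo_y (g r) 1) = Y); last exact/funext.
move=> x0 x1 y0 y1; split.
- by rewrite (der_unique x0 (derN (derD (dvx s) (derN (dY s))))); ring.
- by rewrite (der_unique x1 (derN (derD (dvy s) (derD (derC mu s) (dX s))))); ring.
- exact: der_unique y0 (dX s).
- exact: der_unique y1 (dY s).
Qed.

Let velocity_kernel s G : is_derive s (1 : R) g G ->
  characteristic_kernel (regularized_surface mu c Earth) (g s) G.
Proof.
move=> dg.
have TG : tangent_space (regularized_surface mu c Earth) (g s) G.
  exists (fun r => g (s + r)); split; first by rewrite addr0.
    by exists 1 => //= r _; exact: surface_g.
  have E : (fun h : R => h^-1 *: (g (h + s) - g s)) =
      (fun h : R => h^-1 *: (g (s + (h + 0)) - g (s + 0))).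
    by apply/funext => h; rewrite !addr0 (addrC h).
  by apply/is_deriveP; move/is_deriveP: dg; rewrite E.
split => // v Tv.
have [[sphere _] _] := surface_g s; have [g1 _ _] := regular_g s.
rewrite (stereo_symplectic sphere g1 (tangent_space_tangent_vector TG)
  (tangent_space_tangent_vector Tv)).
have [-> -> -> ->] := velocity_stereo dg.
have := tangent_space_energy (regular_g s) Tv.
rewrite /energy_diff stereo_x0 stereo_x1 stereo_y0 stereo_y1 earth_g moon_g => E.
(* The pairing of the velocity with [v] is [- r] times dH(v), which vanishes on tangent vectors. *)
transitivity (- r s * 0); last by rewrite mulr0.
by rewrite -E /Ux /Uy; ring.
Qed.

Let velocity_neq0 s G : is_derive s (1 : R) g G -> G <> 0.
Proof.
move=> dg G0; have [_ _] := velocity_stereo dg; rewrite G0 /stereo_dy /= !mxE.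
rewrite !(mul0r, mulr0, subr0, addr0) => /esym/eqP + /esym/eqP.
rewrite !mulf_eq0 (negPf (r0 s)) /= invr_eq0 (negPf (r0 s)) !orbF pnatr_eq0 /= => /eqP v1 /eqP v2.
have [n1 n2] := nondegenerate s.
(* Multiplicativity of the complex modulus: [|z|^2 |z'|^2 = |z z'|^2], and [z z'] vanishes here. *)
have : sqnorm (u s) (w s) * sqnorm (a s) (b s) = 0.
  transitivity ((u s * a s - w s * b s) ^+ 2 + (u s * b s + w s * a s) ^+ 2).
    by rewrite /sqnorm; ring.
  by rewrite v1 v2 expr0n/= addr0.
by move/eqP; rewrite mulf_eq0 !gt_eqF.
Qed.

(** z itself only changes sign after [2 * T], but position and momentum are even in [(z, z')]. *)
Let g_periodic s : g (s + 2 * T) = g s.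
Proof.
rewrite /g /q /p /vx /vy /X /Y /r; have [-> -> -> ->] := half_period s.
by rewrite /lc_point /sqnorm !sqrrN !mulrN !mulNr !opprK.
Qed.

(** Squaring is injective on a closed quadrant: [(x + i y)^2] determines its modulus [sqnorm x y],
    hence [y ^+ 2], and the quadrant fixes the sign of [y]. *)
Let square_root_unique (x y x' y' : R) : 0 <= x -> y <= 0 -> 0 <= x' -> y' <= 0 ->
  0 < sqnorm x y -> x ^+ 2 - y ^+ 2 = x' ^+ 2 - y' ^+ 2 -> x * y = x' * y' -> y = y'.
Proof.
move=> x0 y0 x'0 y'0 n0 h1 h2.
have n1 : sqnorm x y = sqnorm x' y'.
  apply/eqP; rewrite -(eqrXn2 (n := 2)) ?sqnorm_ge0//; apply/eqP.
  transitivity ((x ^+ 2 - y ^+ 2) ^+ 2 + 4 * (x * y) ^+ 2); first by rewrite /sqnorm; ring.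
  by rewrite h1 h2 /sqnorm; ring.
have yy : (- y) ^+ 2 = (- y') ^+ 2 by move: n1; rewrite /sqnorm !sqrrN; lra.
apply: oppr_inj; apply/eqP; rewrite -(eqrXn2 (n := 2)) ?oppr_ge0//.
by rewrite yy.
Qed.

Let w_decreasing s s' : 0 <= s -> s < s' -> s' <= T -> w s' < w s.
Proof.
move=> s0 ss s'T; rewrite -ltrN2.
apply: (increasing_derive ss (fun x _ => derN (dw x))) => x /andP[x1 x2].
have xT : 0 <= x < T by lra.
by rewrite oppr_gt0; case: (before xT).
Qed.

Let quadrant s : 0 <= s <= T -> 0 <= u s /\ w s <= 0.
Proof.
move=> /andP[s0 sT]; split.
  move: sT; rewrite le_eqVlt => /predU1P[->|sT]; first by rewrite uT.
  have sT' : 0 <= s < T by rewrite s0.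
  by have [/ltW] := before sT'.
move: s0; rewrite le_eqVlt => /predU1P[<-|s0]; first by rewrite w0.
have sT' : 0 < s <= T by rewrite s0.
by have [_ /ltW] := after sT'.
Qed.

Let half_injective s s' : 0 <= s <= T -> 0 <= s' <= T -> X s = X s' -> Y s = Y s' -> s = s'.
Proof.
move=> sT s'T hX hY; have [u1 w1] := quadrant sT; have [u2 w2] := quadrant s'T.
have [n1 _] := nondegenerate s.
have hxy : u s * w s = u s' * w s'.
  by apply: (@mulfI _ (2 : R)); rewrite ?pnatr_eq0// !mulrA.
have ww := square_root_unique u1 w1 u2 w2 n1 hX hxy.
have [sT0 sT1] := andP sT; have [s'T0 s'T1] := andP s'T.
have [ss|ss|//] := ltgtP s s'.
  by have := w_decreasing sT0 ss s'T1; rewrite ww ltxx.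
by have := w_decreasing s'T0 ss sT1; rewrite ww ltxx.
Qed.

(** The sign of [Y] separates the halves: [Y <= 0] on [0, T], and [Y > 0] on the open interval from
    [T] to [2 * T], which is the reflection of the first half. Within a half the square root stays
    in one quadrant and [w] is strictly monotone. *)
Let g_injective s s' : 0 <= s < 2 * T -> 0 <= s' < 2 * T -> g s = g s' -> s = s'.
Proof.
move=> sT s'T gg.
have hX : X s = X s' by rewrite -!stereo_y0 gg.
have hY : Y s = Y s' by rewrite -!stereo_y1 gg.
have XY x : X (2 * T - x) = X x /\ Y (2 * T - x) = - Y x.
  by rewrite /X /Y; have [-> -> _ _] := mirror x; rewrite sqrrN mulrN mulNr.
have neg x : 0 <= x <= T -> Y x <= 0.
  by move=> /quadrant[u1 w1]; rewrite /Y mulr_ge0_le0// mulr_ge0.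
have pos x : T < x < 2 * T -> 0 < Y x.
  move=> xT; have [_] := XY (2 * T - x); rewrite subKr => ->.
  have h1 : 0 <= 2 * T - x < T by lra.
  have h2 : 0 < 2 * T - x <= T by lra.
  have [u1 _] := before h1; have [_ w1] := after h2.
  by rewrite oppr_gt0 /Y pmulr_rlt0// mulr_gt0.
have [sT1|sT1] := leP s T; have [s'T1|s'T1] := leP s' T.
- by apply: half_injective => //; lra.
- have h1 : 0 <= s <= T by lra.
  have h2 : T < s' < 2 * T by lra.
  by have := neg s h1; have := pos s' h2; lra.
- have h1 : 0 <= s' <= T by lra.
  have h2 : T < s < 2 * T by lra.
  by have := neg s' h1; have := pos s h2; lra.
- have [X1 Y1] := XY s; have [X2 Y2] := XY s'.
  have := half_injective (s := 2 * T - s) (s' := 2 * T - s').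
  have h1 : 0 <= 2 * T - s <= T by lra.
  have h2 : 0 <= 2 * T - s' <= T by lra.
  by move=> /(_ h1 h2); rewrite X1 X2 Y1 Y2 hX hY => /(_ erefl erefl); lra.
Qed.

Lemma retrograde_closed_leaf : exists L, closed_leaf (regularized_surface mu c Earth) L.
Proof.
have [G [dg cG]] := velocity.
have gG s : derive1 g s = G s by rewrite derive1E; exact: derive_val.
exists (range g), (2 * T), g; split; first by rewrite mulr_gt0.
split => //; split; last first.
  by move=> s; split; [exact: surface_g|rewrite gG; exact: velocity_kernel].
split.
- by move=> s; case: (dg s).
- by rewrite (funext gG).
- by move=> s; rewrite gG; exact: velocity_neq0 (dg s).
- exact: g_periodic.
- exact: g_injective.
Qed.

End ClosedLeaf.

Theorem corollary1p6 (R : realType) (mu c : R) (l1 : 'rV[R]_2) :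
  0 < mu < 1 ->
  is_ell1 mu l1 ->
  c < hamiltonian mu (L1 l1) ->
  exists (P : primary) (L : set (ambient R)),
    closed_leaf (regularized_surface mu c P) L.
Proof.
move=> mu01 /(ell1_critical mu01)[t [t01 crit ->]] ct.
have kt : (1 - mu) * tidal t + mu * tidal (1 - t) < mu * (1 - mu) / 2 - c by lra.
have [u [w [a [b [T orbit]]]]] := retrograde_exists mu01 t01 crit kt.
by exists Earth; exact: (retrograde_closed_leaf mu01 t01 crit kt orbit).
Qed.
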